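(* Let $F$ be an algebraically closed field. If $A$ is a prolongable monomial $F$-algebra with the property that $\mathcal P(A)\cong\mathcal P(F\langle x_1,\dots,x_d\rangle)$ (isomorphism of proalgebraic varieties), then $A\cong F\langle x_1,\dots,x_d\rangle$.
   Context: A monomial algebra is a quotient $A=F\langle x_1,\dots,x_m\rangle/I$ of a free associative algebra by a proper ideal generated by monomials, graded by $\deg x_i=1$. It is (right) prolongable if for every non-zero monomial $u\in A$ there is a non-empty monomial $v$ with $uv\ne0$. A point module is a graded cyclic right $A$-module $P=\bigoplus_{n\ge0}P_n$ generated in degree $0$ with all $\dim_F P_n=1$. Writing $P_i=Fe_i$, $e_i\cdot x_j=\lambda_{i,j}e_{i+1}$, its isomorphism class is recorded by $(\underline\lambda_0,\underline\lambda_1,\dots)\in\mathbb P^{m-1}\times\mathbb P^{m-1}\times\cdots$, $\underline\lambda_i=[\lambda_{i,1}:\cdots:\lambda_{i,m}]$. $\mathcal P_n(A)\subseteq(\mathbb P^{m-1})^{\times(n+1)}$ is the projection of the set of all such sequences to the first $n+1$ factors (a projective variety), and $\mathcal P(A)=\{(\mathcal P_n(A),\pi_n)\}_{n\ge0}$ with $\pi_n\colon\mathcal P_{n+1}(A)\to\mathcal P_n(A)$ the natural projections. (For the free algebra, $\mathcal P_n=(\mathbb P^{d-1})^{\times(n+1)}$.) A proalgebraic variety is a sequence $\{(V_n,\varphi_n)\}_{n\ge0}$ of algebraic varieties and surjective morphisms $\varphi_n\colon V_{n+1}\to V_n$; $\varphi^{i'}_i\colon V_{i'}\to V_i$ denotes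 the composite. Points are compatible sequences $(a_n)_n$, $a_n\in V_n$. A morphism $\{(V_n,\varphi_n)\}\to\{(W_n,\psi_n)\}$ consists of an order-preserving $g\colon\mathbb N\to\mathbb N$ (possibly defined only for large arguments) and morphisms of varieties $f_j\colon V_{g(j)}\to W_j$ with $f_j\circ\varphi^{g(j')}_{g(j)}=\psi^{j'}_j\circ f_{j'}$ for $j\le j'$; it induces a map on points. An isomorphism is a morphism with an inverse morphism, i.e. the induced maps on points are mutually inverse. *)

(* Defs.v *)
From HB Require Import structures.
From Stdlib Require Import Classical_Prop.
From mathcomp Require Import all_boot all_algebra finmap.
From mathcomp Require Import monalg mpoly.

Set Implicit Arguments.
Unset Strict Implicit.
Unset Printing Implicit Defensive.

Import GRing.Theory.
Local Open Scope ring_scope.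

Definition freealg (F : fieldType) (m : nat) : Type := {malg F[{fmonom 'I_m}]}.

HB.instance Definition _ (F : fieldType) (m : nat) :=
  GRing.Lalgebra.on (freealg F m).

Fact freealg_scaleAr (F : fieldType) (m : nat) (c : F) (p q : freealg F m) :
  c *: (p * q) = p * (c *: q).
Proof.
pose ev (r : freealg F m) : malg {fmonom 'I_m} F := r.
apply/(@malgP {fmonom 'I_m} F) => w; rewrite (monalg.mcoeffZ c (ev p * ev q)).
rewrite (monalg.mcoeffMl (ev p) (ev q)).
rewrite (@monalg.mcoeffMlw _ _ _ _ (ev p) (c *: ev q) w
  (fsubset_refl _) (monalg.msuppZ_le c _)).
rewrite mulr_sumr; apply: eq_bigr => w1 _.
rewrite mulr_sumr; apply: eq_bigr => w2 _.
by rewrite monalg.mcoeffZ -mulrnAr mulrnAr mulrCA mulrnAr.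
Qed.

HB.instance Definition _ (F : fieldType) (m : nat) :=
  GRing.Lalgebra_isAlgebra.Build F (freealg F m) (@freealg_scaleAr F m).

Definition mon (F : fieldType) (m : nat) (w : {fmonom 'I_m}) : freealg F m :=
  << w >>.

Definition ideal_gen (R : nzRingType) (S : R -> Prop) (p : R) : Prop :=
  exists (n : nat) (a s b : 'I_n -> R),
    (forall i, S (s i)) /\ p = \sum_(i < n) a i * s i * b i.

(* The quotient F<x_1, ..., x_m>/I is given by its projection from the free
   algebra.  I is proper because the carrier of an algType is non-zero. *)
Record monalgebra (F : fieldType) (m : nat) := MonAlgebra {
  ma_sort :> algType F;
  ma_proj : {lrmorphism freealg F m -> ma_sort};
  ma_rel : {fmonom 'I_m} -> Prop;
  ma_surj : forall a : ma_sort, exists p, ma_proj p = a;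
  ma_ker : forall p, ma_proj p = 0 <->
    ideal_gen (fun q => exists2 w, ma_rel w & q = mon F w) p
}.

Definition ma_mon (F : fieldType) (m : nat) (A : monalgebra F m)
  (w : {fmonom 'I_m}) : A := ma_proj A (mon F w).

Definition ma_gen (F : fieldType) (m : nat) (A : monalgebra F m)
  (j : 'I_m) : A := ma_mon A (fmu j).

Definition ma_degree (F : fieldType) (m : nat) (A : monalgebra F m)
  (n : nat) (a : A) : Prop :=
  exists2 p : freealg F m,
    (forall w, w \in monalg.msupp p -> fdeg w = n) & a = ma_proj A p.

Definition prolongable (F : fieldType) (m : nat) (A : monalgebra F m) : Prop :=
  forall u, ma_mon A u != 0 ->
  exists2 v, v != mone & ma_mon A u * ma_mon A v != 0.

Definition alg_iso (F : fieldType) (A B : algType F) : Prop :=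
  exists f : {lrmorphism A -> B}, bijective f.

Fact freealg_surj (F : fieldType) (m : nat) (a : freealg F m) :
  exists p : freealg F m, idfun p = a.
Proof. by exists a. Qed.

Fact freealg_ker (F : fieldType) (m : nat) (p : freealg F m) :
  idfun p = 0 <-> ideal_gen (fun q => exists2 w, False & q = mon F w) p.
Proof.
split=> [/= -> | [[|n] [a [s [b [Hs ->]]]]]]; last 2 first.
- by rewrite /= big_ord0.
- by have [] := Hs ord0.
by exists 0, (fun=> 0), (fun=> 0), (fun=> 0); split; [case|rewrite big_ord0].
Qed.

Definition free_monalgebra (F : fieldType) (m : nat) : monalgebra F m :=
  @MonAlgebra F m (freealg F m) idfun (fun=> False)
    (@freealg_surj F m) (@freealg_ker F m).

(* Right A-modules are left modules over the converse ring. *)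

Definition ract (F : fieldType) (A : algType F) (P : lmodType A^c)
  (v : P) (a : A) : P := (a : A^c) *: v.

Record graded_module (F : fieldType) (m : nat) (A : monalgebra F m)
    (P : lmodType A^c) (gr : nat -> P -> Prop) : Prop := {
  gm_zero : forall n, gr n 0;
  gm_add : forall n u v, gr n u -> gr n v -> gr n (u + v);
  gm_scale : forall n (c : F) v, gr n v -> gr n (ract v c%:A);
  gm_span : forall v, exists N (u : nat -> P),
    (forall n, gr n (u n)) /\ v = \sum_(n < N) u n;
  gm_direct : forall N (u : nat -> P), (forall n, gr n (u n)) ->
    \sum_(n < N) u n = 0 -> forall n, (n < N)%N -> u n = 0;
  gm_act : forall i j v (a : A),
    gr i v -> ma_degree j a -> gr (i + j)%N (ract v a)
}.

Record point_module (F : fieldType) (m : nat) (A : monalgebra F m)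
    (P : lmodType A^c) (gr : nat -> P -> Prop) : Prop := {
  pm_graded : graded_module gr;
  pm_cyclic : exists2 v, gr 0%N v & forall u, exists a : A, u = ract v a;
  pm_dim1 : forall n, exists2 e, e != 0 &
    forall v, gr n v <-> exists c : F, v = ract e c%:A
}.

Record projspace (F : fieldType) (m : nat) := ProjSpace {
  pline :> {vspace 'rV[F]_m};
  _ : \dim pline == 1%N
}.
HB.instance Definition _ (F : fieldType) (m : nat) :=
  [isSub of projspace F m for @pline F m].

(* l is the class of a point module with P_i = F e_i and
   e_i x_j = lam_(i,j) e_(i+1). *)
Definition point_seq (F : fieldType) (m : nat) (A : monalgebra F m)
    (l : nat -> projspace F m) : Prop :=
  exists (P : lmodType A^c) (gr : nat -> P -> Prop), point_module gr /\
  exists (e : nat -> P) (lam : nat -> 'rV[F]_m),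
    [/\ forall i, e i != 0 /\ gr i (e i),
        forall i j, ract (e i) (ma_gen A j) = ract (e i.+1) (lam i 0 j)%:A
      & forall i, pline (l i) = <[lam i]>%VS].

Definition multiproj (F : fieldType) (k m : nat) : Type :=
  {ffun 'I_k -> projspace F m}.

(* Row i holds homogeneous coordinates of the i-th component.  Only the
   vanishing of multihomogeneous polynomials, and quotients of two of them of
   the same multidegree, are used below; these do not depend on the choice. *)
Definition hcoord (F : fieldType) (k m : nat) (x : multiproj F k m) :
  'M[F]_(k, m) := \matrix_(i, j) vpick (x i) 0 j.

(* The variable X_(i,j) has number mxvec_index i j. *)
Definition heval (F : fieldType) (k m : nat)
  (p : mpoly (k * m)%N F) (x : multiproj F k m) : F :=
  p.@[fun t => mxvec (hcoord x) 0 t].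

Definition multihom (F : fieldType) (k m : nat) (D : 'I_k -> nat)
  (p : mpoly (k * m)%N F) : Prop :=
  forall mm, mm \in msupp p ->
  forall i : 'I_k, (\sum_(j < m) mm (mxvec_index i j))%N = D i.

Definition zclosed (F : fieldType) (k m : nat)
    (Z : multiproj F k m -> Prop) : Prop :=
  exists2 S : mpoly (k * m)%N F -> Prop,
    (forall p, S p -> exists D, multihom D p) &
    (forall x, Z x <-> forall p, S p -> heval p x = 0).

(* A (possibly reducible) projective variety, as a Zariski-closed subset of
   (P^(v_var - 1))^v_fac. *)
Record variety (F : fieldType) := Variety {
  v_fac : nat;
  v_var : nat;
  v_locus : multiproj F v_fac v_var -> Prop;
  v_closed : zclosed v_locus
}.

Definition vpt (F : fieldType) (V : variety F) : Type := {x | v_locus (v := V) x}.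

Definition zopen (F : fieldType) (V : variety F) (U : vpt V -> Prop) : Prop :=
  exists2 S : mpoly (v_fac V * v_var V)%N F -> Prop,
    (forall p, S p -> exists D, multihom D p) &
    (forall x, U x <-> exists2 p, S p & heval p (sval x) != 0).

Definition regular_on (F : fieldType) (V : variety F)
    (U : vpt V -> Prop) (h : vpt V -> F) : Prop :=
  forall x, U x ->
  exists N : vpt V -> Prop, [/\ zopen N, N x &
    exists D (p q : mpoly (v_fac V * v_var V)%N F),
      [/\ multihom D p, multihom D q &
          forall y, N y -> heval q (sval y) != 0 /\
                           h y = heval p (sval y) / heval q (sval y)]].

(* Continuous maps that pull regular functions back to regular functions. *)
Definition vmorphism (F : fieldType) (V W : variety F)
    (f : vpt V -> vpt W) : Prop :=
  forall U, zopen U ->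
    zopen (fun x => U (f x)) /\
    forall h, regular_on U h -> regular_on (fun x => U (f x)) (fun x => h (f x)).

Record provariety (F : fieldType) := ProVariety {
  pv_lvl :> nat -> variety F;
  pv_proj : forall n, vpt (pv_lvl n.+1) -> vpt (pv_lvl n);
  pv_proj_morphism : forall n, vmorphism (pv_proj (n := n));
  pv_proj_surj : forall n y, exists x, pv_proj (n := n) x = y
}.

Fixpoint pv_proj_add (F : fieldType) (V : provariety F) (n k : nat) :
    vpt (V (k + n)%N) -> vpt (V n) :=
  match k with
  | 0 => id
  | k'.+1 => fun x => pv_proj_add (pv_proj (n := (k' + n)%N) x)
  end.

Definition pv_down (F : fieldType) (V : provariety F) (i i' : nat)
    (le_i : (i <= i')%N) (x : vpt (V i')) : vpt (V i) :=
  pv_proj_add (ecast n (vpt (V n)) (esym (subnK le_i)) x).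

Definition pv_point (F : fieldType) (V : provariety F)
    (a : forall n, vpt (V n)) : Prop :=
  forall n, pv_proj (a n.+1) = a n.

(* The index function is defined from pvm_start on; the values of pvm_idx and
   pvm_map below pvm_start are irrelevant. *)
Record pvmorphism (F : fieldType) (V W : provariety F) := PVMorphism {
  pvm_start : nat;
  pvm_idx : nat -> nat;
  pvm_idx_le : forall j j', (pvm_start <= j)%N -> (j <= j')%N ->
    (pvm_idx j <= pvm_idx j')%N;
  pvm_map : forall j, vpt (V (pvm_idx j)) -> vpt (W j);
  pvm_map_morphism : forall j, (pvm_start <= j)%N -> vmorphism (pvm_map (j := j));
  pvm_map_comm : forall j j' (le_s : (pvm_start <= j)%N) (le_j : (j <= j')%N)
      (x : vpt (V (pvm_idx j'))),
    pvm_map (pv_down (pvm_idx_le le_s le_j) x) = pv_down le_j (pvm_map x)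
}.

(* The map induced on points: b_j is the projection of
   f_j' (a_(g j')), where j' is the maximum of j and the start of f. *)
Definition pv_map (F : fieldType) (V W : provariety F) (f : pvmorphism V W)
    (a : forall n, vpt (V n)) (j : nat) : vpt (W j) :=
  pv_down (leq_maxr (pvm_start f) j) (pvm_map (p := f) (a (pvm_idx f _))).

Definition pv_iso (F : fieldType) (V W : provariety F) : Prop :=
  exists (f : pvmorphism V W) (g : pvmorphism W V),
    (forall a, pv_point a -> forall n, pv_map g (pv_map f a) n = a n) /\
    (forall b, pv_point b -> forall n, pv_map f (pv_map g b) n = b n).

(* For w = x_(j_1) ... x_(j_k), the scalar by which e_i w is a multiple of
   e_(i+k), when e_i x_j = c_(i,j) e_(i+1). *)
Fixpoint wprod (F : fieldType) (m : nat) (c : nat -> 'rV[F]_m) (i : nat)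
    (w : seq 'I_m) : F :=
  if w is j :: w' then c i 0 j * wprod c i.+1 w' else 1.

Definition pcoord (F : fieldType) (m : nat) (l : projspace F m) : 'rV[F]_m :=
  vpick l.

Lemma pcoord_neq0 (F : fieldType) (m : nat) (l : projspace F m) :
  pcoord l != 0.
Proof.
case: l => U dU; rewrite /pcoord /= vpick0; apply: contraTneq dU => ->.
by rewrite dimv0.
Qed.

Lemma pcoord_line (F : fieldType) (m : nat) (l : projspace F m) :
  pline l = <[pcoord l]>%VS.
Proof.
apply/esym/eqP; rewrite eqEdim dim_vline pcoord_neq0.
rewrite -memvE memv_pick /=; by case: l => U /= /eqP ->.
Qed.

Lemma line_coord0 (F : fieldType) (m : nat) (u v : 'rV[F]_m) (j : 'I_m) :
  <[u]>%VS = <[v]>%VS -> (u 0 j == 0) -> (v 0 j == 0).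
Proof.
move=> uv /eqP u0; have: v \in <[u]>%VS by rewrite uv memv_line.
by case/vlineP=> k ->; rewrite mxE u0 mulr0.
Qed.

Lemma wprod_eq0 (F : fieldType) (m : nat) (c c' : nat -> 'rV[F]_m) i w :
  (forall i j, c i 0 j == 0 -> c' i 0 j == 0) ->
  wprod c i w = 0 -> wprod c' i w = 0.
Proof.
move=> cc'; elim: w i => [|j w IHw] i //=.
move/eqP; rewrite mulf_eq0 => /orP[/cc'/eqP->|/eqP/IHw->]; first by rewrite mul0r.
by rewrite mulr0.
Qed.

Section RightAction.
Variables (F : fieldType) (A : algType F) (P : lmodType A^c).
Implicit Types (u v : P) (a b : A) (c : F).

Lemma ractDl u v a : ract (u + v) a = ract u a + ract v a.
Proof. exact: scalerDr. Qed.
Lemma ractDr u a b : ract u (a + b) = ract u a + ract u b.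
Proof. exact: scalerDl. Qed.
Lemma ractM u a b : ract u (a * b) = ract (ract u a) b.
Proof. by rewrite /ract scalerA. Qed.
Lemma ract1 u : ract u 1 = u.
Proof. exact: scale1r. Qed.
Lemma ract0 u : ract u 0 = 0.
Proof. exact: scale0r. Qed.
Lemma ractC u c a : ract (ract u c%:A) a = ract (ract u a) c%:A.
Proof. by rewrite -!ractM mulr_algl mulr_algr. Qed.
Lemma ractA_eq0 u c : u != 0 -> ract u c%:A = 0 -> c = 0.
Proof.
move=> u0 uc; apply/eqP; apply: contraNT u0 => c0.
rewrite -[u]ract1 -[1]scale1r -(divff c0) -scalerA -mulr_algl ractM uc.
by rewrite /ract scaler0.
Qed.
End RightAction.

Lemma monM (F : fieldType) (m : nat) (u v : {fmonom 'I_m}) :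
  mon F (mmul u v) = mon F u * mon F v.
Proof.
rewrite /mon -[RHS]/((<< u >> : malg _ F) * (<< v >> : malg _ F)).
by rewrite malgM_def fgmulUU mulr1.
Qed.

Lemma mon_nil (F : fieldType) (m : nat) : mon F (FMonom [::] : {fmonom 'I_m}) = 1.
Proof. by rewrite -fmoneE. Qed.

Lemma fmonom_cons (m : nat) (j : 'I_m) (w : seq 'I_m) :
  FMonom (j :: w) = mmul (fmu j) (FMonom w).
Proof. by apply/eqP; rewrite fmP fmM fmU. Qed.

Lemma point_seq_wprod (F : fieldType) (m : nat) (A : monalgebra F m)
    (l : nat -> projspace F m) :
  point_seq A l ->
  forall w, ma_rel A w -> forall i, wprod (fun i => pcoord (l i)) i w = 0.
Proof.
case=> P [gr [_ [e [lam [He Hlam Hl]]]]] w Aw i.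
suff: wprod lam i w = 0.
  apply: wprod_eq0 => {}i j; apply: line_coord0.
  by rewrite -Hl pcoord_line.
have Hact (s : seq 'I_m) k :
    ract (e k) (ma_mon A (FMonom s)) = ract (e (k + size s)%N) (wprod lam k s)%:A.
  elim: s k => [|j s IHs] k.
    by rewrite addn0 /= scale1r ract1 /ma_mon mon_nil rmorph1 ract1.
  rewrite fmonom_cons /ma_mon monM rmorphM ractM Hlam ractC IHs -addSnnS.
  by rewrite -ractM mulr_algl scalerA mulrC.
have w0 : ma_mon A w = 0.
  apply/ma_ker; exists 1, (fun=> 1), (fun=> mon F w), (fun=> 1).
  by split=> [_|]; [exists w | rewrite big_ord1 mul1r mulr1].
have := Hact w i; rewrite (fmK w) w0 ract0 => /esym; apply: ractA_eq0.
by have [] := He (i + size w)%N.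
Qed.

Section PointModule.
Variables (F : fieldType) (m : nat) (A : monalgebra F m).
Variable (c : nat -> 'rV[F]_m).
Hypothesis c_rel : forall w, ma_rel A w -> forall i, wprod c i w = 0.
Hypothesis c_neq0 : forall i, c i != 0.

(* The right action with e_i x_j = c_(i,j) e_(i+1), where e_i = 'X^i. *)
Definition wact (w : seq 'I_m) (q : {poly F}) : {poly F} :=
  \sum_(i < size q) (q`_i * wprod c i w) *: 'X^(i + size w).

Lemma wactE n w (q : {poly F}) : (size q <= n)%N ->
  wact w q = \sum_(i < n) (q`_i * wprod c i w) *: 'X^(i + size w).
Proof.
move=> qn; rewrite /wact (big_ord_widen n (fun i => (q`_i * wprod c i w) *: 'X^(i + size w))) //.
rewrite big_mkcond; apply: eq_bigr => i _; case: ltnP => // qi.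
by rewrite nth_default // mul0r scale0r.
Qed.

Lemma wact_is_linear w : linear (wact w).
Proof.
move=> a p q; pose n := maxn (size p) (size q).
have pn : (size p <= n)%N by exact: leq_maxl.
have qn : (size q <= n)%N by exact: leq_maxr.
have rn : (size (a *: p + q)%R <= n)%N.
  rewrite (leq_trans (size_polyD _ _)) // geq_max qn andbT.
  by rewrite (leq_trans (size_scale_leq _ _)).
rewrite (wactE w pn) (wactE w qn) (wactE w rn) scaler_sumr -big_split /=.
apply: eq_bigr => i _.
by rewrite coefD coefZ mulrDl scalerDl scalerA mulrA.
Qed.
HB.instance Definition _ w :=
  GRing.isLinear.Build F {poly F} {poly F} _ (wact w) (wact_is_linear w).

Lemma wactX w i : wact w 'X^i = wprod c i w *: 'X^(i + size w).
Proof.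
have Xn : (size ('X^i : {poly F}) <= i.+1)%N by rewrite size_polyXn.
rewrite (wactE w Xn) big_ord_recr /= big1 ?add0r; last first.
  by move=> j _; rewrite coefXn (ltn_eqF (ltn_ord j)) mul0r scale0r.
by rewrite coefXn eqxx mul1r.
Qed.

Lemma wprod_cat i u v : wprod c i (u ++ v) = wprod c i u * wprod c (i + size u) v.
Proof.
elim: u i => [|j u IHu] i /=; first by rewrite mul1r addn0.
by rewrite IHu mulrA addSnnS.
Qed.

Lemma poly_lin_ext (f g : {linear {poly F} -> {poly F}}) :
  (forall i, f 'X^i = g 'X^i) -> f =1 g.
Proof.
move=> fg q; rewrite -[q]coefK poly_def !linear_sum.
by apply: eq_bigr => i _; rewrite !linearZ fg.
Qed.

Lemma wact_cat u v q : wact (u ++ v) q = wact v (wact u q).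
Proof.
apply: (@poly_lin_ext (wact (u ++ v)) (wact v \o wact u)) => i /=.
by rewrite !wactX linearZ /= wactX wprod_cat scalerA size_cat addnA.
Qed.

Lemma wact_nil q : wact [::] q = q.
Proof.
apply: (@poly_lin_ext (wact [::]) idfun) => i /=.
by rewrite wactX scale1r addn0.
Qed.

Lemma wact_rel w q : ma_rel A w -> wact w q = 0.
Proof.
move=> Aw; apply: (@poly_lin_ext (wact w) \0) => i /=.
by rewrite wactX c_rel // scale0r.
Qed.

Definition free_act (p : freealg F m) (q : {poly F}) : {poly F} :=
  \sum_(w <- monalg.msupp p) monalg.mcoeff w p *: wact w q.

Lemma free_actEw (d : {fset {fmonom 'I_m}}) (p : freealg F m) q :
  (monalg.msupp p `<=` d)%fset ->
  free_act p q = \sum_(w <- d) monalg.mcoeff w p *: wact w q.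
Proof.
move=> le; rewrite /free_act (big_fset_incl _ le) => //= w wd.
by move/monalg.mcoeff_outdom=> ->; rewrite scale0r.
Qed.

Lemma free_act_linear p : linear (free_act p).
Proof.
move=> a u v; rewrite /free_act scaler_sumr -big_split /=.
by apply: eq_bigr => w _; rewrite linearP scalerDr !scalerA mulrC.
Qed.
HB.instance Definition _ p :=
  GRing.isLinear.Build F {poly F} {poly F} _ (free_act p) (free_act_linear p).

Lemma free_act_linearl q : linear (free_act^~ q).
Proof.
move=> a u v.
pose d := (monalg.msupp u `|` monalg.msupp v `|` monalg.msupp (a *: u + v))%fset.
have Hu : (monalg.msupp u `<=` d)%fset.
  by rewrite /d -fsetUA fsubsetUl.
have Hv : (monalg.msupp v `<=` d)%fset.
  by rewrite /d fsetUAC fsubsetUr.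
have Hw : (monalg.msupp (a *: u + v) `<=` d)%fset by rewrite fsubsetUr.
rewrite (free_actEw q Hu) (free_actEw q Hv) (free_actEw q Hw) scaler_sumr -big_split /=.
apply: eq_bigr => w _.
rewrite monalg.mcoeffD (monalg.mcoeffZ a (u : malg _ F)).
by rewrite scalerDl scalerA.
Qed.

Definition free_act_r q p := free_act p q.
HB.instance Definition _ q :=
  GRing.isLinear.Build F (freealg F m) {poly F} _ (free_act_r q) (free_act_linearl q).

Lemma free_act_mon w q : free_act (mon F w) q = wact w q.
Proof.
rewrite /free_act /mon monalg.msuppU oner_eq0 big_seq_fset1 monalg.mcoeffU.
by rewrite eqxx scale1r.
Qed.

Lemma freealgE (p : freealg F m) :
  p = \sum_(w <- monalg.msupp p) monalg.mcoeff w p *: mon F w.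
Proof.
rewrite [LHS](@monalgE {fmonom 'I_m} F).
apply: eq_bigr => w _; rewrite /mon.
apply/(@malgP {fmonom 'I_m} F) => k.
rewrite (monalg.mcoeffZ _ (<< w >> : malg _ F)) !monalg.mcoeffU.
by rewrite mulrnAr mulr1.
Qed.

Lemma freealg_ind (Q : freealg F m -> Prop) :
  Q 0 -> (forall a p q, Q p -> Q q -> Q (a *: p + q)) ->
  (forall w, Q (mon F w)) -> forall p, Q p.
Proof.
move=> Q0 Qlin Qmon p; rewrite [p]freealgE.
apply: (big_ind Q) => [//|u v Qu Qv|w _].
  by rewrite -[u]scale1r; apply: Qlin.
by rewrite -[_ *: _]addr0; apply: Qlin.
Qed.

Lemma free_actM p p' q : free_act (p * p') q = free_act p' (free_act p q).
Proof.
elim/freealg_ind: p => [|a u v IHu IHv|w].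
- by rewrite mul0r -!/(free_act_r _ _) linear0 /free_act_r linear0.
- rewrite mulrDl -scalerAl -!/(free_act_r _ _) !linearP /= /free_act_r IHu IHv.
  by rewrite linearP.
elim/freealg_ind: p' => [|a u v IHu IHv|w'].
- by rewrite mulr0 -!/(free_act_r _ _) !linear0.
- by rewrite mulrDr -scalerAr -!/(free_act_r _ _) !linearP /= /free_act_r IHu IHv.
by rewrite -monM !free_act_mon fmM wact_cat.
Qed.

Lemma free_act_ker p q : ma_proj A p = 0 -> free_act p q = 0.
Proof.
case/ma_ker=> n [a [s [b [Hs ->]]]]; rewrite -/(free_act_r q _) linear_sum big1 //.
move=> i _; rewrite /= /free_act_r !free_actM; have [w Aw ->] := Hs i.
by rewrite free_act_mon wact_rel // linear0.
Qed.

Fact ma_surjb (a : A) : exists p, ma_proj A p == a.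
Proof. by have [p <-] := ma_surj a; exists p. Qed.

Definition pmact (a : A^c) (q : {poly F}) : {poly F} :=
  free_act (xchoose (ma_surjb a)) q.

Lemma pmactE p q : pmact (ma_proj A p) q = free_act p q.
Proof.
rewrite /pmact; set p' := xchoose _.
have /eqP Hp' : ma_proj A p' == ma_proj A p := xchooseP (ma_surjb _).
apply/eqP; rewrite -subr_eq0 -!/(free_act_r q _) -linearB /= /free_act_r free_act_ker //.
by rewrite rmorphB /= Hp' subrr.
Qed.

Definition pmod_of
  (_ : forall w, ma_rel A w -> forall i, wprod c i w = 0) : Type := {poly F}.
Local Notation pmod := (pmod_of c_rel).
HB.instance Definition _ := GRing.Zmodule.on pmod.

Fact pmactA (a b : A^c) (v : pmod) : pmact a (pmact b v) = pmact (a * b) v.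
Proof.
have [p Hp] := ma_surj (a : A); have [p' Hp'] := ma_surj (b : A).
rewrite -Hp -Hp' !pmactE -free_actM -pmactE; congr (pmact _ _).
by rewrite rmorphM.
Qed.
Fact pmact1 : left_id (1 : A^c) (pmact : A^c -> pmod -> pmod).
Proof.
move=> v; rewrite -[v in RHS]wact_nil -[[::]]/(FMonom [::] : seq 'I_m).
rewrite -free_act_mon -pmactE; congr (pmact _ _).
by rewrite mon_nil rmorph1.
Qed.
Fact pmactDr : right_distributive (pmact : A^c -> pmod -> pmod) +%R.
Proof. by move=> a u v; rewrite /pmact linearD. Qed.
Fact pmactDl (v : pmod) :
  {morph (pmact^~ v : A^c -> pmod) : a b / a + b >-> a + b}.
Proof.
move=> a b; have [p Hp] := ma_surj (a : A); have [p' Hp'] := ma_surj (b : A).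
rewrite -Hp -Hp' !pmactE -[RHS]/(free_act_r v p + free_act_r v p') -linearD /=.
by rewrite /free_act_r -pmactE rmorphD.
Qed.

HB.instance Definition _ := GRing.Zmodule_isLmodule.Build A^c pmod
  pmactA pmact1 pmactDr pmactDl.

Lemma pmod_ractE (v : pmod) p : ract v (ma_proj A p) = free_act p v.
Proof. exact: pmactE. Qed.

Lemma pmod_ractA (v : pmod) (k : F) :
  ract v (k%:A : A) = (k *: (v : {poly F}) : {poly F}).
Proof.
rewrite -(rmorph1 (ma_proj A)) -linearZ /= pmod_ractE -/(free_act_r v _) linearZ /=.
suff -> : free_act_r v 1 = v by [].
by rewrite /free_act_r -pmod_ractE rmorph1; exact: (@ract1 F A pmod v).
Qed.

Definition pmgr (n : nat) (v : pmod) : Prop :=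
  exists k : F, v = (k *: ('X^n : {poly F}) : {poly F}).

Lemma pmod_gen n j :
  ract ('X^n : pmod) (ma_gen A j) = (c n 0 j *: 'X^(n.+1) : {poly F}).
Proof. by rewrite pmod_ractE free_act_mon wactX fmU /= mulr1 addn1. Qed.

Lemma pmod_graded : @graded_module F m A pmod pmgr.
Proof.
split=> [n|n _ _ [a ->] [b ->]|n a _ [b ->]|v|N u Hu su n nN|i j _ _ [a ->] [p Hp ->]].
- by exists 0; rewrite scale0r.
- by exists (a + b); rewrite scalerDl.
- by exists (a * b); rewrite pmod_ractA scalerA.
- exists (size (v : {poly F})), (fun n => (v : {poly F})`_n *: ('X^n : {poly F})).
  split=> [n|]; first by exists (v : {poly F})`_n.
  by rewrite -[LHS]coefK poly_def.
- have [k Hk] := Hu n; rewrite Hk; suff -> : k = 0 by rewrite scale0r.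
  have su' : \sum_(i < N) (u i : {poly F}) = 0 := su.
  have := congr1 (fun q : {poly F} => q`_n) su'; rewrite /= coef0.
  rewrite coef_sum (bigD1 (Ordinal nN)) //= big1 ?addr0 => [|i ni].
    by rewrite Hk coefZ coefXn eqxx mulr1.
  have [b ->] := Hu i; rewrite coefZ coefXn eq_sym.
  by rewrite -val_eqE /= in ni; rewrite (negPf ni) mulr0.
rewrite pmod_ractE linearZ /= /free_act.
exists (a * \sum_(w <- monalg.msupp p) monalg.mcoeff w p * wprod c i w).
rewrite -scalerA scaler_suml.
suff -> : \sum_(w <- monalg.msupp p) monalg.mcoeff w p *: wact w 'X^i =
  \sum_(w <- monalg.msupp p)
     (monalg.mcoeff w p * wprod c i w) *: 'X^(i + j) by [].
rewrite !big_seq; apply: eq_bigr => w wp; rewrite wactX scalerA.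
by rewrite -[size w]/(fdeg w) (Hp _ wp).
Qed.

Lemma pmod_point : @point_module F m A pmod pmgr.
Proof.
split; first exact: pmod_graded.
  exists ('X^0 : pmod); first by exists 1; rewrite scale1r.
  have HX n : exists a : A, 'X^n = ract ('X^0 : pmod) a.
    elim: n => [|n [a IHn]]; first by exists 1; rewrite ract1.
    have /rV0Pn[j cj] := c_neq0 n.
    exists (a * ma_gen A j * (c n 0 j)^-1%:A).
    rewrite !ractM -IHn pmod_gen pmod_ractA scalerA mulVf //.
    by rewrite scale1r.
  move=> u; rewrite -[u]coefK poly_def.
  apply: (big_ind (fun v => exists a : A, v = ract ('X^0 : pmod) a)).
  - by exists 0; rewrite ract0.
  - by move=> _ _ [a ->] [b ->]; exists (a + b); rewrite ractDr.
  move=> i _; have [a Ha] := HX i; exists (a * ((u : {poly F})`_i)%:A).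
  by rewrite ractM -Ha pmod_ractA.
move=> n; exists ('X^n : pmod); first by rewrite -size_poly_eq0 size_polyXn.
by move=> v; split=> -[k ->]; exists k; rewrite pmod_ractA.
Qed.
End PointModule.

Lemma wprod_point_seq (F : fieldType) (m : nat) (A : monalgebra F m)
    (l : nat -> projspace F m) :
  (forall w, ma_rel A w -> forall i, wprod (fun i => pcoord (l i)) i w = 0) ->
  point_seq A l.
Proof.
move=> Hrel; set c := fun i => _ in Hrel.
have c0 i : c i != 0 by exact: pcoord_neq0.
exists (pmod_of Hrel), (@pmgr F m A c Hrel); split; first exact: pmod_point.
exists (fun n => 'X^n : {poly F}), c; split=> [n|n j|n].
- split; first by rewrite -size_poly_eq0 size_polyXn.
  by exists 1; rewrite scale1r.
- by rewrite pmod_gen pmod_ractA.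
exact: pcoord_line.
Qed.

Lemma point_seqP (F : fieldType) (m : nat) (A : monalgebra F m)
    (l : nat -> projspace F m) :
  point_seq A l <->
  forall w, ma_rel A w -> forall i, wprod (fun i => pcoord (l i)) i w = 0.
Proof. by split; [exact: point_seq_wprod | exact: wprod_point_seq]. Qed.

Definition point_locus (F : fieldType) (m : nat) (A : monalgebra F m) (n : nat)
    (x : multiproj F n.+1 m) : Prop :=
  exists2 l, point_seq A l & forall i : 'I_n.+1, x i = l i.

Section Multihom.
Variables (F : fieldType) (k m : nat).
Implicit Types (D : 'I_k -> nat) (p q : mpoly (k * m)%N F).

Lemma multihom_ext D D' p : D =1 D' -> multihom D p -> multihom D' p.
Proof. by move=> DD' Dp mm pmm i; rewrite -DD' Dp. Qed.

Lemma multihomZ D a p : multihom D p -> multihom D (a *: p).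
Proof. by move=> Dp mm /msuppZ_le; exact: Dp. Qed.

Lemma multihomD D p q : multihom D p -> multihom D q -> multihom D (p + q).
Proof.
by move=> Dp Dq mm /msuppD_le; rewrite mem_cat => /orP[]; [exact: Dp | exact: Dq].
Qed.

Lemma multihom0 D : multihom D (0 : mpoly (k * m)%N F).
Proof. by move=> mm; rewrite msupp0. Qed.

Lemma multihom1 : multihom (fun=> 0%N) (1 : mpoly (k * m)%N F).
Proof.
move=> mm; rewrite msupp1 inE => /eqP-> i.
by rewrite big1 // => j _; rewrite mnm0E.
Qed.

Lemma multihomM D D' p q :
  multihom D p -> multihom D' q -> multihom (fun i => D i + D' i)%N (p * q).
Proof.
move=> Dp Dq mm /msuppM_le/allpairsP[[m1 m2] /= [m1p m2q ->]] i.
rewrite -(Dp _ m1p) -(Dq _ m2q) -big_split /=.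
by apply: eq_bigr => j _; rewrite mnmDE.
Qed.

Lemma multihomXn D p n : multihom D p -> multihom (fun i => n * D i)%N (p ^+ n).
Proof.
move=> Dp; elim: n => [|n IHn].
  by apply: multihom_ext multihom1.
by rewrite exprS; apply: multihom_ext (multihomM Dp IHn) => i; rewrite mulSn.
Qed.

Lemma multihom_prod (I : Type) (r : seq I) (P : pred I) (E : I -> 'I_k -> nat)
    (G : I -> mpoly (k * m)%N F) :
  (forall i, P i -> multihom (E i) (G i)) ->
  multihom (fun j => \sum_(i <- r | P i) E i j)%N (\prod_(i <- r | P i) G i).
Proof.
move=> EG; elim: r => [|i r IHr].
  by rewrite big_nil; apply: multihom_ext multihom1 => j; rewrite big_nil.
rewrite big_cons; case: (boolP (P i)) => Pi.
  apply: multihom_ext (multihomM (EG i Pi) IHr) => j.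
  by rewrite big_cons Pi.
by apply: multihom_ext IHr => j; rewrite big_cons (negPf Pi).
Qed.

Lemma multihom_sum (I : Type) (r : seq I) (P : pred I) D
    (G : I -> mpoly (k * m)%N F) :
  (forall i, P i -> multihom D (G i)) ->
  multihom D (\sum_(i <- r | P i) G i).
Proof.
by move=> DG; apply: big_ind => //; [exact: multihom0 | exact: multihomD].
Qed.

Lemma multihomX (i : 'I_k) (j : 'I_m) :
  multihom (fun i' => (i' == i : nat)) ('X_(mxvec_index i j) : mpoly (k * m)%N F).
Proof.
move=> mm; rewrite msuppX inE => /eqP-> i'.
have inj2 (u v : 'I_k * 'I_m) :
    (mxvec_index u.1 u.2 == mxvec_index v.1 v.2) = (u == v).
  case: u v => [u1 u2] [v1 v2]; apply/eqP/eqP => [|[-> ->] //] /=.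
  have [g fK _] := curry_mxvec_bij k m.
  by move=> uv; rewrite -(fK (u1, u2) isT) /= uv (fK (v1, v2) isT).
under eq_bigr => j' _.
  rewrite mnm1E (inj2 (i, j) (i', j')) xpair_eqE eq_sym (eq_sym j).
  over.
case: eqP => /= _; last by rewrite big1.
by rewrite (bigD1 j) //= eqxx big1 // => j' /negPf->.
Qed.

Lemma hevalX (i : 'I_k) (j : 'I_m) (x : multiproj F k m) :
  heval 'X_(mxvec_index i j) x = hcoord x i j.
Proof. by rewrite /heval mevalXU mxvecE. Qed.
End Multihom.

(* Points of P_n(A) are stable under shrinking the support. *)
Lemma point_locus_supp (F : fieldType) (m : nat) (A : monalgebra F m) (n : nat)
    (x y : multiproj F n.+1 m) :
  (forall i j, hcoord x i j == 0 -> hcoord y i j == 0) ->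
  point_locus A x -> point_locus A y.
Proof.
move=> xy [l /point_seqP Al xl].
exists (fun i => if insub i is Some i' then y i' else l i) => [|i]; last first.
  by rewrite valK.
apply/point_seqP => w Aw i; have := Al w Aw i; apply: wprod_eq0 => {}i j.
case: insubP => // i' _ <-; rewrite -xl => H.
by have := xy i' j; rewrite !mxE; apply.
Qed.

Lemma point_locus_closed (F : fieldType) (m : nat) (A : monalgebra F m)
  (n : nat) : zclosed (@point_locus F m A n).
Proof.
pose supp_pol (y : multiproj F n.+1 m) : mpoly (n.+1 * m)%N F :=
  \prod_i \prod_(j | hcoord y i j != 0) 'X_(mxvec_index i j).
have supp_polE y x : heval (supp_pol y) x =
    \prod_i \prod_(j | hcoord y i j != 0) hcoord x i j.
  rewrite /heval /supp_pol rmorph_prod; apply: eq_bigr => i _.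
  rewrite rmorph_prod; apply: eq_bigr => j _; exact: hevalX.
exists (fun p => exists2 y, ~ point_locus A y & p = supp_pol y).
  move=> _ [y _ ->]; eexists; apply: multihom_prod => i _.
  apply: multihom_prod => j _; exact: multihomX.
move=> x; split=> [Ax _ [y Ay ->]|Hx].
  apply/eqP; rewrite supp_polE; apply: contra_notT Ay => nz.
  apply: point_locus_supp Ax => i j; apply: contraTT => yij.
  move/prodf_neq0: nz => /(_ i isT) /prodf_neq0 /(_ j yij) //.
apply: NNPP => Ax; have /eqP := Hx _ (ex_intro2 _ _ x Ax erefl).
rewrite supp_polE; apply/negP; apply/prodf_neq0 => i _.
by apply/prodf_neq0.
Qed.

Definition point_variety (F : fieldType) (m : nat) (A : monalgebra F m)
  (n : nat) : variety F := Variety (@point_locus_closed F m A n).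

Definition mp_restr (F : fieldType) (n m : nat) (x : multiproj F n.+2 m) :
  multiproj F n.+1 m := [ffun i => x (widen_ord (leqnSn _) i)].

Fact point_locus_restr (F : fieldType) (m : nat) (A : monalgebra F m) (n : nat)
  (x : multiproj F n.+2 m) : point_locus A x -> point_locus A (mp_restr x).
Proof. by case=> l Al xl; exists l => // i; rewrite ffunE xl. Qed.

Definition point_proj (F : fieldType) (m : nat) (A : monalgebra F m) (n : nat)
    (x : vpt (point_variety A n.+1)) : vpt (point_variety A n) :=
  exist _ (mp_restr (sval x)) (point_locus_restr (svalP x)).

Fact point_proj_surj (F : fieldType) (m : nat) (A : monalgebra F m) (n : nat)
  (y : vpt (point_variety A n)) : exists x, point_proj x = y.
Proof.
case: y => y Ay; have [l Al yl] := Ay.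
pose x : multiproj F n.+2 m := [ffun i : 'I_n.+2 => l i].
have Ax : point_locus A x by exists l => // i; rewrite ffunE.
exists (exist _ x Ax); rewrite /point_proj /=.
have xy : mp_restr x = y by apply/ffunP => i; rewrite !ffunE yl.
by move: (point_locus_restr _); rewrite xy => Ay'; rewrite (proof_irrelevance _ Ay' Ay).
Qed.

Definition mp_subst (F : fieldType) (n m : nat) (p : mpoly (n.+1 * m)%N F) :
    mpoly (n.+2 * m)%N F :=
  p \mPo [tuple mxvec (\matrix_(i < n.+1, j < m)
    ('X_(mxvec_index (widen_ord (leqnSn _) i) j) : mpoly (n.+2 * m)%N F)) 0 t
    | t < (n.+1 * m)%N].

Lemma heval_subst (F : fieldType) (n m : nat) (p : mpoly (n.+1 * m)%N F)
  (x : multiproj F n.+2 m) : heval (mp_subst p) x = heval p (mp_restr x).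
Proof.
rewrite /heval /mp_subst comp_mpoly_meval; apply: meval_eq => t.
rewrite tnth_map tnth_ord_tuple.
case/mxvec_indexP: t => i j; rewrite !mxvecE !mxE.
by rewrite -[LHS]/(heval _ x) hevalX !mxE ffunE.
Qed.

Lemma multihom_subst (F : fieldType) (n m : nat) (D : 'I_n.+1 -> nat)
    (p : mpoly (n.+1 * m)%N F) :
  multihom D p ->
  multihom (fun i' => \sum_(i < n.+1) (i' == widen_ord (leqnSn _) i) * D i)%N
    (mp_subst p).
Proof.
move=> Dp; rewrite /mp_subst comp_mpolyE big_seq.
apply: multihom_sum => mm pmm; apply: multihomZ.
pose E (t : 'I_(n.+1 * m)) (i' : 'I_n.+2) : nat :=
  (mm t * mxvec (\matrix_(i < n.+1, j < m)
     (i' == widen_ord (leqnSn _) i : nat)) ord0 t)%N.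
have HE : multihom (fun i' => \sum_t E t i')%N
    (\prod_(t < (n.+1 * m)%N) tnth [tuple mxvec (\matrix_(i < n.+1, j < m)
    ('X_(mxvec_index (widen_ord (leqnSn _) i) j) : mpoly (n.+2 * m)%N F)) 0 t
    | t < (n.+1 * m)%N] t ^+ mm t).
  apply: multihom_prod => t _; apply: multihomXn.
  rewrite tnth_map tnth_ord_tuple.
  case/mxvec_indexP: t => i j; rewrite !mxvecE !mxE.
  by apply: multihom_ext (@multihomX F _ _ _ j) => i'; rewrite mxvecE mxE.
apply: multihom_ext HE => i'.
rewrite (reindex _ (curry_mxvec_bij _ _)) /=.
transitivity (\sum_(u : 'I_n.+1 * 'I_m) E (mxvec_index u.1 u.2) i')%N.
  by apply: eq_bigr => -[i j] _.
rewrite -(pair_bigA _ (fun i j => E (mxvec_index i j) i')) /=.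
apply: eq_bigr => i _; rewrite -(Dp _ pmm i) big_distrr /=.
by apply: eq_bigr => j _; rewrite /E mxvecE mxE mulnC.
Qed.

Lemma point_proj_open (F : fieldType) (m : nat) (A : monalgebra F m) (n : nat)
    (U : vpt (point_variety A n) -> Prop) :
  zopen U -> zopen (fun x => U (point_proj x)).
Proof.
case=> S homS US; exists (fun q => exists2 p, S p & q = mp_subst p).
  by move=> _ [p /homS[D Dp] ->]; eexists; exact: multihom_subst Dp.
move=> x; split=> [/US[p Sp px]|[_ [p Sp ->]]].
  by exists (mp_subst p); [exists p | rewrite heval_subst].
by rewrite heval_subst => px; apply/US; exists p.
Qed.

Fact point_proj_morphism (F : fieldType) (m : nat) (A : monalgebra F m)
  (n : nat) : vmorphism (point_proj (A := A) (n := n)).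
Proof.
move=> U oU; split; first exact: point_proj_open.
move=> h hU x Ux; have [N [oN Nx [D [p [q [Dp Dq hpq]]]]]] := hU _ Ux.
exists (fun y => N (point_proj y)); split=> //; first exact: point_proj_open.
eexists; exists (mp_subst p), (mp_subst q).
split; [exact: multihom_subst Dp | exact: multihom_subst Dq |].
by move=> y /hpq; rewrite !heval_subst.
Qed.

Definition point_provariety (F : fieldType) (m : nat) (A : monalgebra F m) :
    provariety F :=
  @ProVariety F (point_variety A) (@point_proj F m A)
    (@point_proj_morphism F m A) (@point_proj_surj F m A).

(* Main.v *)
From HB Require Import structures.
From Stdlib Require Import Classical ClassicalEpsilon.
Require Import Defs.
From mathcomp Require Import all_boot all_algebra.
From mathcomp Require Import ring zify.
From mathcomp Require Import mpoly.

(* Surjectivity from an irreducible variety makes every P_n(A) irreducible, so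
   P(A) is a product of coordinate subspaces P(S_0) x P(S_1) x ... with
   decreasing S_i, and prolongability says that a word is non-zero in A exactly
   when its k-th letter lies in S_k for all k.  It remains to see that all the
   S_i have d elements.

   Suppose that psi o phi is the projection to the j-th factor, where
   phi : X -> Y and psi : Y -> P^a are morphisms and X, Y are products of
   projective spaces.  Evaluating the i-th component of phi at a moving point t
   of a line of X and the others at another point t' of it gives a morphism
   P^1 x P^1 -> P^a that is linear on the diagonal, hence of bidegree (1, 0) or
   (0, 1).  So some single component phi_i already determines the j-th
   coordinate, by a morphism.  Comparing tangent spaces, the coordinates
   determined by one factor P(T_i) have total dimension at most |T_i| - 1.
   Applied in both directions, this gives |S_0| <= d and embeds the factors of
   the free side injectively into those i with |S_i| >= d. *)

Set Implicit Arguments.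
Unset Strict Implicit.
Unset Printing Implicit Defensive.

Import GRing.Theory.
Local Open Scope ring_scope.

(** * Morphisms from a product of two projective lines *)

(** Two obstacles shape the proof. A morphism is given by forms only near each point, and no global
    formula for it is at hand. On a line with two parameters, however, all local tuples are
    multiples of one primitive polynomial tuple, which therefore has no affine zero; a
    representation valid at (infinity, infinity) then compares its bidegree with its degree on the
    diagonal, which is at most 1. Secondly, a morphism of proalgebraic varieties shifts levels, so
    at a finite level an isomorphism is only a retraction onto the coordinates [j <= n], and
    comparing dimensions of whole levels is not conclusive. Hence the search for a single factor
    that determines each coordinate. *)

Lemma ex_minimizer (T : Type) (Q : T -> Prop) (f : T -> nat) :
  (exists x, Q x) -> exists2 x, Q x & forall y, Q y -> (f x <= f y)%N.
Proof.
case=> x; have [n] := ubnP (f x); elim: n x => // n IHn x ltn Qx.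
case: (classic (exists2 y, Q y & (f y < f x)%N)) => [[y Qy yx]|nyx].
  by apply: (IHn y) => //; exact: leq_trans yx _.
exists x => // y Qy; rewrite leqNgt; apply/negP => yx; apply: nyx.
by exists y.
Qed.

(** Proportionality as the vanishing of all 2x2 minors. The zero tuple is colinear to everything, so
    forms with unwanted zeros still qualify; transitivity then needs a non-zero middle tuple. *)
Definition colinear (R : comNzRingType) (I : Type) (u v : I -> R) : Prop :=
  forall a b, u a * v b = u b * v a.

Lemma colinear_sym (R : comNzRingType) (I : Type) (u v : I -> R) :
  colinear u v -> colinear v u.
Proof. by move=> uv a b; rewrite mulrC -uv mulrC. Qed.

Lemma colinear_trans (R : idomainType) (I : Type) (u v w : I -> R) c :
  v c != 0 -> colinear u v -> colinear v w -> colinear u w.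
Proof.
move=> vc uv vw a b; apply: (mulfI vc).
transitivity (v c * u a * w b); first by rewrite mulrA.
rewrite [v c * _]mulrC uv -mulrA vw mulrA -[u c * _]uv.
by ring.
Qed.

Lemma colinear_scale (F : fieldType) (I : Type) (u v : I -> F) c :
  v c != 0 -> colinear u v -> forall a, u a = u c / v c * v a.
Proof. by move=> vc uv a; rewrite mulrAC -uv mulfK. Qed.

Section BivariateMap.
Variable F : closedFieldType.

Lemma poly_eq0_eval (p : {poly F}) : (forall t, p.[t] = 0) -> p = 0.
Proof.
by move=> p0; apply/eqP/negPn/negP => /closed_nonrootP[t]; rewrite /root p0 eqxx.
Qed.

Lemma poly2_eq0_eval (p : {poly {poly F}}) :
  (forall t t', p.[t, t'] = 0) -> p = 0.
Proof.
move=> p0; apply/eqP; rewrite -swapXY_eq0; apply/eqP/polyP => i.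
rewrite coef0; apply: poly_eq0_eval => t.
have: p.[t%:P] = 0 by apply: poly_eq0_eval => t'; exact: p0.
rewrite horner_polyC => /polyP/(_ i).
by rewrite coef_map coef0.
Qed.

Lemma poly_const_noroot (p : {poly F}) :
  (forall t, p.[t] != 0) -> exists2 k, k != 0 & p = k%:P.
Proof.
move=> p0; have /eqP s1 : size p == 1%N.
  by apply/negPn/negP => /closed_rootP[t]; rewrite /root (negPf (p0 t)).
exists p`_0; last by apply: size1_polyC; rewrite s1.
by have := p0 0; rewrite horner_coef0.
Qed.

Variable M : nat.
Implicit Types P R : 'I_M -> {poly {poly F}}.

Lemma inner_root_factor (p : {poly {poly F}}) tau :
  map_poly (horner_eval tau) p = 0 ->
  exists p', p = ('X - tau%:P)%:P * p'.
Proof.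
move=> p0; exists (\poly_(i < size p) (p`_i %/ ('X - tau%:P))).
apply/polyP => i; rewrite coefCM coef_poly; case: ltnP => ip; last first.
  by rewrite mulr0 nth_default.
rewrite mulrC divpK // dvdp_XsubCl /root; apply/eqP.
by have /polyP/(_ i) := p0; rewrite coef_map coef0.
Qed.

(* Over an algebraically closed field the content of a bivariate polynomial can
   be removed one linear factor at a time, so no Gauss lemma is needed. *)
Lemma primitive_tuple R (c : 'I_M) : R c != 0 ->
  exists P, [/\ P c != 0, colinear P R &
    forall R', colinear R' P -> exists q, forall a, R' a = q * P a].
Proof.
move=> Rc; pose Q P := P c != 0 /\ colinear P R.
(* Two successive minima: the outer degree at [c] will make remainders of pseudo-division vanish,
   and the degree of the leading coefficient excludes a common linear factor in the inner
   variable. *)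
have [P1 [P1c P1R] minP1] : exists2 P, Q P & forall P', Q P' ->
    (size (P c) <= size (P' c))%N.
  apply: (@ex_minimizer _ _ (fun P => size (P c))); exists R; split=> // a b.
  exact: mulrC.
pose Q' P := Q P /\ size (P c) = size (P1 c).
have [P [[Pc PR] Psz] minP] : exists2 P, Q' P & forall P', Q' P' ->
    (size (lead_coef (P c)) <= size (lead_coef (P' c)))%N.
  by apply: (@ex_minimizer _ _ (fun P => size (lead_coef (P c)))); exists P1.
have colP R' : colinear R' P -> colinear R' R by move=> R'P; exact: colinear_trans Pc R'P PR.
have zP R' : colinear R' P -> R' c = 0 -> forall a, R' a = 0.
  move=> R'P R'c a; apply: (mulIf Pc).
  by rewrite R'P R'c !mul0r.
have prim tau : exists a, map_poly (horner_eval tau) (P a) != 0.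
  apply: NNPP => /not_ex_all_not nP.
  have fP a : exists p', P a = ('X - tau%:P)%:P * p'.
    by apply: inner_root_factor; apply/eqP/negPn/negP; exact: nP.
  have [P' P'E] : exists P', forall a, P a = ('X - tau%:P)%:P * P' a.
    exact: (fin_all_exists fP).
  have X0 : ('X - tau%:P)%:P != 0 :> {poly {poly F}}.
    by rewrite polyC_eq0 polyXsubC_eq0.
  have P'c : P' c != 0 by apply: contraNneq Pc => p0; rewrite P'E p0 mulr0.
  have szE : size (P c) = size (P' c).
    by rewrite P'E mul_polyC size_scale // polyXsubC_eq0.
  have /minP : Q' P'.
    split; last by rewrite -szE.
    split=> // a b; apply: (mulfI X0).
    by rewrite !mulrA -!P'E PR.
  rewrite P'E mul_polyC lead_coefZ size_monicM ?monicXsubC ?lead_coef_eq0 //.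
  by rewrite size_XsubC /= ltnn.
exists P; split=> // R' R'P.
(* A denominator [d] in the inner variable is harmless: at a root [tau] of [d] some entry of [P]
   survives, so [q] vanishes there too and the linear factor cancels. *)
suff [d [q [d0 dq]]] : exists d q, d != 0 /\ forall a, d%:P * R' a = q * P a.
  have [n] := ubnP (size d); elim: n d q d0 dq => // n IHn d q d0 dq dn.
  have [/eqP d1|/closed_rootP[tau dtau]] := boolP (size d == 1%N).
    have dE := size1_polyC (eq_leq d1).
    exists (((d`_0)^-1)%:P%:P * q) => a.
    rewrite -mulrA -dq mulrA -polyCM dE coefC /= -polyCM mulVf ?polyC1 ?mul1r //.
    by apply: contraNneq d0 => d00; rewrite dE d00.
  have [d' d'E] : exists d', d = ('X - tau%:P) * d'.
    by exists (d %/ ('X - tau%:P)); rewrite mulrC divpK // dvdp_XsubCl.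
  have qtau : map_poly (horner_eval tau) q = 0.
    have [a Pa] := prim tau; apply: (mulIf Pa); rewrite mul0r -rmorphM -dq rmorphM /=.
    rewrite map_polyC /= /horner_eval; move/rootP: dtau => ->.
    by rewrite polyC0 mul0r.
  have [q' q'E] := inner_root_factor qtau.
  have X0 : ('X - tau%:P)%:P != 0 :> {poly {poly F}}.
    by rewrite polyC_eq0 polyXsubC_eq0.
  apply: (IHn d' q').
  - by apply: contraNneq d0 => d'0; rewrite d'E d'0 mulr0.
  - by move=> a; apply: (mulfI X0); rewrite !mulrA -polyCM -d'E -q'E.
  have d'0 : d' != 0 by apply: contraNneq d0 => d'0; rewrite d'E d'0 mulr0.
  by move: dn; rewrite d'E size_monicM ?monicXsubC // size_XsubC /= ltnS.
pose k := Pdiv.Ring.rscalp (R' c) (P c).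
pose q := Pdiv.Ring.rdivp (R' c) (P c).
exists (lead_coef (P c) ^+ k), q; split; first by rewrite expf_neq0 ?lead_coef_eq0.
have Deq := Pdiv.ComRing.rdivp_eq (P c) (R' c).
rewrite -mul_polyC -/k -/q in Deq.
(* The tuple [D] is proportional to [P]. Its entry at [c] is a remainder, of smaller degree than
   [P c], hence zero by minimality, and then the whole tuple is zero. *)
pose D a := (lead_coef (P c) ^+ k)%:P * R' a - q * P a.
have DP : colinear D P.
  by move=> a b; rewrite /D !mulrBl -!mulrA R'P [P a * P b]mulrC.
have Dc : D c = Pdiv.Ring.rmodp (R' c) (P c) by rewrite /D Deq addrAC subrr add0r.
suff D0 : D c = 0 by move=> a; apply/eqP; rewrite -subr_eq0; apply/eqP; exact: zP DP D0 a.
apply/eqP/negPn/negP => Dc0; have := minP1 _ (conj Dc0 (colP _ DP)).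
by rewrite -Psz Dc leqNgt Pdiv.Ring.ltn_rmodp Pc.
Qed.

Lemma horner_diag (q : {poly {poly F}}) t : q.['X].[t] = q.[t, t].
Proof.
rewrite [q.['X]]horner_coef [q.[t%:P]]horner_coef !horner_sum.
by apply: eq_bigr => i _; rewrite !hornerE.
Qed.

Lemma sizeY_mul (p q : {poly {poly F}}) : p != 0 -> q != 0 ->
  sizeY (p * q) = (sizeY p + sizeY q).-1.
Proof. by move=> p0 q0; rewrite !sizeYE rmorphM size_mul ?swapXY_eq0. Qed.

(* The curve t -> Psi t t is a line, so Psi has bidegree (1, 0) or (0, 1). *)
Lemma bivariate_line (Psi : F -> F -> 'I_M -> F) (l0 l1 : 'I_M -> F) :
  (forall t t', exists c, Psi t t' c != 0) ->
  (forall t, colinear (Psi t t) (fun c => l0 c + t * l1 c)) ->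
  ~ colinear l0 l1 ->
  (forall t0 t0', exists2 R, exists c, (R c).[t0, t0'] != 0 &
     forall t t', colinear (fun c => (R c).[t, t']) (Psi t t')) ->
  (exists R a b, [/\ forall c, (size (R c) <= a.+1)%N,
     forall c, (sizeY (R c) <= b.+1)%N,
     exists c, (R c)`_a`_b != 0 &
     forall t t', colinear (fun c => (R c).[t, t']) (Psi t t')]) ->
  (forall t t', colinear (Psi t t') (fun c => l0 c + t * l1 c)) \/
  (forall t t', colinear (Psi t t') (fun c => l0 c + t' * l1 c)).
Proof.
(* The non-zero coefficient in the extreme bidegree makes [Ri] a representation near (infinity,
   infinity), where [loc] says nothing. *)
move=> Psi0 PsiL l01 loc [Ri [a [b [szX szY [ci Rci] RiPsi]]]].
pose rep R := forall t t', colinear (fun c => (R c).[t, t']) (Psi t t').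
have rep_col R R' : rep R -> rep R' -> colinear R R'.
  move=> RPsi R'Psi c c'; apply/eqP; rewrite -subr_eq0; apply/eqP.
  apply: poly2_eq0_eval => t t'; have [e Pe] := Psi0 t t'.
  have /(_ c c') := colinear_trans Pe (RPsi t t') (colinear_sym (R'Psi t t')).
  by rewrite !hornerE => ->; rewrite subrr.
have Ri0 : Ri ci != 0 by apply: contraNneq Rci => ->; rewrite !coef0.
have [P [Pci PRi univ]] := primitive_tuple Ri0.
have facP R : rep R -> exists q, forall c, R c = q * P c.
  move=> /rep_col/(_ RiPsi) RRi; apply: univ.
  exact: colinear_trans Ri0 RRi (colinear_sym PRi).
have repP : rep P.
  move=> t t'; have [R [c Rc] RPsi] := loc t t'.
  have [q Rq] := facP _ RPsi => e e'.
  have := RPsi t t' e e'; rewrite !Rq !hornerE -!mulrA; apply: mulfI.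
  by apply: contraNneq Rc => q0; rewrite Rq !hornerE q0 mul0r.
have Pdiag t : exists c, (P c).[t, t] != 0.
  have [R [c Rc] RPsi] := loc t t; have [q Rq] := facP _ RPsi.
  by exists c; apply: contraNneq Rc => P0; rewrite Rq !hornerE P0 mulr0.
have PL t : colinear (fun c => (P c).[t, t]) (fun c => l0 c + t * l1 c).
  have [e Pe] := Psi0 t t; exact: colinear_trans Pe (repP t t) (PsiL t).
pose L c : {poly F} := (l0 c)%:P + (l1 c) *: 'X.
(* On the diagonal [P] is proportional to the line [L]; as [l0] and [l1] are independent, Cramer's
   rule with the minor [mn] makes it a polynomial multiple. The factor has no root because [P] does
   not vanish on the diagonal, so it is constant. *)
have [k k0 PdE] : exists2 k, k != 0 & forall c, (P c).['X] = k%:P * L c.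
  have [c [c' minor]] : exists c c', l0 c * l1 c' - l0 c' * l1 c != 0.
    apply: NNPP => nm; apply: l01 => c c'; apply/eqP; rewrite -subr_eq0.
    by apply/negPn/negP => m0; apply: nm; exists c, c'.
  set mn := _ - _ in minor.
  pose k := (mn^-1)%:P * ((l1 c')%:P * (P c).['X] - (l1 c)%:P * (P c').['X]).
  have kE e : (P e).['X] = k * L e.
    have colX : colinear (fun e => (P e).['X]) L.
      move=> e1 e2; apply/eqP; rewrite -subr_eq0; apply/eqP; apply: poly_eq0_eval => t.
      by rewrite !hornerE !horner_diag ![_ * t]mulrC PL subrr.
    have mE : mn%:P = (l1 c')%:P * L c - (l1 c)%:P * L c'.
      by rewrite /mn /L -!mul_polyC !polyCB !polyCM; ring.
    have mn0 : mn%:P != 0 by rewrite polyC_eq0.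
    apply: (mulfI mn0); rewrite {1}mE /k !mulrA -polyCM divff // polyC1 mul1r.
    rewrite !mulrBl -!mulrA; congr (_ * _ - _ * _).
      by rewrite mulrC colX.
    by rewrite mulrC colX.
  have [t|k1 k10 k1E] := @poly_const_noroot k.
    have [e Pe] := Pdiag t; apply: contraNneq Pe => kt.
    by rewrite -horner_diag kE hornerM kt mul0r.
  by exists k1 => // e; rewrite kE k1E.
have [q Riq] := facP _ RiPsi.
have q0 : q != 0 by apply: contraNneq Ri0 => q0; rewrite Riq q0 mul0r.
(* On the diagonal the entry [ci] of [Ri = q * P] reaches degree [a + b], to which [P] contributes
   at most 1. So [q] uses up all but 1 of the bidegree [(a, b)], which leaves total degree at most 1
   for [P], that is, sizes of sum at most 3. *)
have deg_sum c c' : P c != 0 -> P c' != 0 ->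
    (size (P c) + sizeY (P c') <= 3)%N.
  move=> Pc Pc'.
  have := szX c; rewrite Riq size_mul // => hX.
  have := szY c'; rewrite Riq sizeY_mul // => hY.
  have hd : (a + b < size (Ri ci).['X])%N.
    rewrite ltnNge; apply: contra Rci => /leq_sizeP/(_ (a + b)%N (leqnn _)).
    rewrite (horner_coef_wide _ (szX ci)) coef_sum big_ord_recr /= big1 ?add0r.
      by rewrite coefMXn ltnNge leq_addr /= addKn => ->.
    move=> i _; rewrite coefMXn; case: ltnP => // _; apply: nth_default.
    rewrite (leq_trans (max_size_coefXY _ _)) // (leq_trans (szY ci)) //.
    by have := ltn_ord i; lia.
  have hq := max_size_evalX q.
  have hP : (size (Ri ci).['X] <= (size q.['X]).+1)%N.
    have hs : (size (P ci).['X] <= 2)%N.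
      rewrite PdE mul_polyC (leq_trans (size_scale_leq _ _)) //.
      rewrite (leq_trans (size_polyD _ _)) // geq_max.
      rewrite (leq_trans (size_polyC_leq1 _)) //=.
      by rewrite (leq_trans (size_scale_leq _ _)) // size_polyX.
    rewrite Riq hornerM (leq_trans (size_polyMleq _ _)) //.
    by move: (size _) (size _) hs => u v; lia.
  have q1 : (0 < size q)%N by rewrite size_poly_gt0.
  have q2 : (0 < sizeY q)%N by rewrite lt0n sizeY_eq0.
  move: (leq_trans hd hP) hq hX hY q1 q2.
  move: (size q.['X]) (size q) (sizeY q) (size (P c)) (sizeY (P c')).
  by move=> u v w y z; lia.
have LP t t' s : (forall c, (P c).[t, t'] = (P c).[s, s]) ->
    colinear (Psi t t') (fun c => l0 c + s * l1 c).
  move=> Ps; have [c Pc] := Pdiag s.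
  apply: (@colinear_trans _ _ _ (fun c => (P c).[s, s]) _ c) => //.
  by move=> e e'; have := colinear_sym (repP t t') e e'; rewrite !Ps.
(* Either [P] depends on [t'] only, or some entry has outer degree 1 and [deg_sum] removes [t']. In
   both cases [P] equals one of its diagonal values. *)
case: (classic (forall c, (size (P c) <= 1)%N)) => [sX|nsX].
  right=> t t'; apply: LP => c.
  by rewrite (size1_polyC (sX c)) !hornerC.
left=> t t'; apply: LP => c.
have sY : (sizeY (P c) <= 1)%N.
  have [Pc0|Pc] := eqVneq (P c) 0; first by rewrite Pc0 sizeYE rmorph0 size_poly0.
  have [e /negP] := not_all_ex_not _ _ nsX; rewrite -ltnNge => Pe.
  have Pe0 : P e != 0 by apply: contraTneq Pe => ->; rewrite size_poly0.
  by have := deg_sum e c Pe0 Pc; lia.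
rewrite sizeYE in sY; rewrite -![(P c).[_, _]]horner2_swapXY.
by rewrite (size1_polyC sY) !hornerC.
Qed.
End BivariateMap.

(** * Evaluation of multihomogeneous forms *)

Section MatrixEvaluation.
Variables (F : fieldType) (k m : nat) (B : comNzRingType).
Variable f : {rmorphism F -> B}.
Implicit Types (p : {mpoly F[k * m]}) (X : 'M[B]_(k, m)).

(** Values in a ring [B] over [F] allow points that move with one or two parameters. *)
Definition mxeval X p : B := mmap f (fun t => mxvec X 0 t) p.

Lemma mxevalE X p : mxeval X p = \sum_(mm <- msupp p) f p@_mm *
   \prod_(i < k) \prod_(j < m) X i j ^+ mm (mxvec_index i j).
Proof.
apply: eq_bigr => mm _; congr (_ * _); rewrite /mmap1.
rewrite (reindex _ (curry_mxvec_bij _ _)) /= pair_bigA /=.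
by apply: eq_bigr => -[i j] _; rewrite mxvecE.
Qed.

Lemma mxeval_row_scale D p X (Y : 'M[B]_(k, m)) (c : 'I_k -> B) :
  multihom D p -> (forall i j, Y i j = c i * X i j) ->
  mxeval Y p = (\prod_i c i ^+ D i) * mxeval X p.
Proof.
move=> Dp YX; rewrite !mxevalE mulr_sumr [LHS]big_seq [RHS]big_seq; apply: eq_bigr => mm pmm.
rewrite [RHS]mulrCA; congr (_ * _); rewrite -big_split /=; apply: eq_bigr => i _.
rewrite -(Dp mm pmm) -prodrXr -big_split /=.
by apply: eq_bigr => j _; rewrite YX exprMn.
Qed.

End MatrixEvaluation.

Definition mxev (F : fieldType) (k m : nat) := @mxeval F k m F idfun.
Arguments mxev {F k m} X p.

Lemma mxeval_rmorph (F : fieldType) (k m : nat) (B C : comNzRingType)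
    (f : {rmorphism F -> B}) (h : {rmorphism B -> C}) (g : {rmorphism F -> C})
    (X : 'M[B]_(k, m)) (p : {mpoly F[k * m]}) : (forall c, h (f c) = g c) ->
  h (mxeval f X p) = mxeval g (map_mx h X) p.
Proof.
move=> hf; rewrite rmorph_sum; apply: eq_bigr => mm _.
rewrite rmorphM hf rmorph_prod; congr (_ * _); apply: eq_bigr => t _.
by rewrite rmorphXn -map_mxvec mxE.
Qed.

(* [G a b c q]: c is the coefficient of q in formal bidegree (a, b). *)
Lemma mxeval_graded (F : fieldType) (k m : nat) (B : comNzRingType)
    (f : {rmorphism F -> B}) (G : nat -> nat -> F -> B -> Prop) :
  (forall a b, G a b 0 0) -> G 0%N 0%N 1 1 ->
  (forall a b c c' q q', G a b c q -> G a b c' q' -> G a b (c + c') (q + q')) ->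
  (forall a b e c q, G a b c q -> G a b (e * c) (f e * q)) ->
  (forall a b a' b' c c' q q', G a b c q -> G a' b' c' q' ->
     G (a + a')%N (b + b')%N (c * c') (q * q')) ->
  forall D p (v : 'M[F]_(k, m)) (X : 'M[B]_(k, m)) (al be : 'I_k -> nat), multihom D p ->
  (forall i j, G (al i) (be i) (v i j) (X i j)) ->
  G (\sum_i D i * al i)%N (\sum_i D i * be i)%N
    (mxev v p) (mxeval f X p).
Proof.
move=> G0 G1 GD GZ GM D p v X al be Dp GX.
have Gexp a b c q n : G a b c q -> G (n * a)%N (n * b)%N (c ^+ n) (q ^+ n).
  move=> Gq; elim: n => [|n IHn]; first by rewrite !mul0n !expr0.
  by rewrite !mulSn !exprS; exact: GM.
have Gprod (I : Type) (r : seq I) (a b : I -> nat) (c : I -> F) (q : I -> B) :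
    (forall i, G (a i) (b i) (c i) (q i)) ->
    G (\sum_(i <- r) a i)%N (\sum_(i <- r) b i)%N
      (\prod_(i <- r) c i) (\prod_(i <- r) q i).
  move=> Gq; elim: r => [|i r IHr]; first by rewrite !big_nil.
  by rewrite !big_cons; exact: GM.
rewrite /mxev !mxevalE.
rewrite [X in G _ _ X _]big_seq [X in G _ _ _ X]big_seq;
  apply: (big_rec2 (fun c q => G _ _ c q)) => // mm q c pmm Gqc.
apply: GD => //; apply: GZ.
have -> : (\sum_i D i * al i = \sum_i \sum_j mm (mxvec_index i j) * al i)%N.
  by apply: eq_bigr => i _; rewrite -(Dp mm pmm) big_distrl.
have -> : (\sum_i D i * be i = \sum_i \sum_j mm (mxvec_index i j) * be i)%N.
  by apply: eq_bigr => i _; rewrite -(Dp mm pmm) big_distrl.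
by apply: (Gprod) => i; apply: (Gprod) => j; exact: (Gexp).
Qed.
Definition polyCC (F : fieldType) : {rmorphism F -> {poly {poly F}}} :=
  polyC \o polyC.

Section Substitution.
Variables (F : fieldType) (k m : nat).
Implicit Types (p : {mpoly F[k * m]}) (v w : 'M[F]_(k, m)).

Lemma mxev_horner (X : 'M[{poly F}]_(k, m)) p t :
  (mxeval polyC X p).[t] = mxev (\matrix_(i, j) (X i j).[t]) p.
Proof.
rewrite -[LHS]/(horner_eval t _) (@mxeval_rmorph _ _ _ _ _ _ (horner_eval t) idfun).
  by congr (mxeval _ _ _); apply/matrixP => i j; rewrite !mxE.
by move=> c; rewrite /= /horner_eval hornerC.
Qed.

Lemma mxev_horner2 (X : 'M[{poly {poly F}}]_(k, m)) p t t' :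
  (mxeval (polyCC F) X p).[t, t'] =
  mxev (\matrix_(i, j) (X i j).[t, t']) p.
Proof.
rewrite -[LHS]/((horner_eval t' \o horner_eval t%:P) _).
rewrite (@mxeval_rmorph _ _ _ _ _ _ (horner_eval t' \o horner_eval t%:P) idfun).
  by congr (mxeval _ _ _); apply/matrixP => i j; rewrite !mxE.
by move=> c; rewrite /= /horner_eval !hornerC.
Qed.

(** All [Q c] share the multidegree [D], so rescaling the rows multiplies them by one common
    scalar. *)
Lemma mxev_row_colinear M (D : 'I_k -> nat) (Q : 'I_M -> {mpoly F[k * m]}) v w :
  (forall c, multihom D (Q c)) ->
  (forall i, exists j, v i j != 0) -> (forall i, colinear (w i) (v i)) ->
  exists2 e, (forall c, mxev w (Q c) = e * mxev v (Q c)) &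
    ((forall i, exists j, w i j != 0) -> e != 0).
Proof.
move=> DQ v0 wv.
have /fin_all_exists[s sE] i : exists s, forall j, w i j = s * v i j.
  have [c vc] := v0 i; exists (w i c / v i c) => j.
  exact: colinear_scale vc (wv i) j.
exists (\prod_i s i ^+ D i) => [c|w0]; first exact: mxeval_row_scale.
apply/prodf_neq0 => i _; rewrite expf_neq0 //.
by have [j] := w0 i; apply: contraNneq => s0; rewrite sE s0 mul0r.
Qed.

(** The extreme coefficient for a formal bidegree, that is, the value at (infinity, infinity). It
    may be zero, which makes the notion stable under sums. *)
Definition bilead (a b : nat) (c : F) (q : {poly {poly F}}) : Prop :=
  [/\ (size q <= a.+1)%N, (sizeY q <= b.+1)%N & q`_a`_b = c].

Lemma coefM_top (R : nzRingType) (p q : {poly R}) a b :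
  (size p <= a.+1)%N -> (size q <= b.+1)%N -> (p * q)`_(a + b) = p`_a * q`_b.
Proof.
move=> pa qb; rewrite coefM (bigD1 (inord a)) //= big1 ?addr0.
  by rewrite inordK ?ltnS ?leq_addr // addKn.
move=> i; rewrite -val_eqE /= inordK ?ltnS ?leq_addr // => ia.
have [ai|ia'] := ltnP a i.
  by rewrite nth_default ?mul0r // (leq_trans pa).
by rewrite [q`__]nth_default ?mulr0 // (leq_trans qb) //; lia.
Qed.

Lemma mxeval_bilead (X : 'M[{poly {poly F}}]_(k, m)) v p D (al be : 'I_k -> nat) :
  multihom D p -> (forall i j, bilead (al i) (be i) (v i j) (X i j)) ->
  bilead (\sum_i D i * al i) (\sum_i D i * be i) (mxev v p)
    (mxeval (polyCC F) X p).
Proof.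
apply: (@mxeval_graded F k m _ (polyCC F) bilead).
- by move=> a b; rewrite /bilead sizeYE rmorph0 !size_poly0 !coef0.
- by rewrite /bilead sizeYE rmorph1 !size_poly1 !coef1.
- move=> a b c c' q q' [qa qb <-] [q'a q'b <-]; split.
  + by rewrite (leq_trans (size_polyD _ _)) // geq_max qa.
  + rewrite sizeYE rmorphD (leq_trans (size_polyD _ _)) // -!sizeYE.
    by rewrite geq_max qb.
  by rewrite !coefD.
- move=> a b e c q [qa qb <-] /=; split.
  + by rewrite mul_polyC (leq_trans (size_scale_leq _ _)).
  + rewrite sizeYE rmorphM /= swapXY_polyC map_polyC /= mul_polyC.
    by rewrite (leq_trans (size_scale_leq _ _)) // -sizeYE.
  by rewrite !coefCM.
move=> a b a' b' c c' q q' [qa qb <-] [q'a q'b <-]; split.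
- by rewrite (leq_trans (size_polyMleq _ _)) //; lia.
- rewrite sizeYE rmorphM (leq_trans (size_polyMleq _ _)) // -!sizeYE; lia.
rewrite coefM_top // coefM_top //.
  exact: leq_trans (max_size_coefXY _ _) qb.
exact: leq_trans (max_size_coefXY _ _) q'b.
Qed.

Definition ulead (a : nat) (c : F) (q : {poly F}) : Prop :=
  (size q <= a.+1)%N /\ q`_a = c.

Lemma mxeval_ulead (X : 'M[{poly F}]_(k, m)) v p D (al : 'I_k -> nat) :
  multihom D p -> (forall i j, ulead (al i) (v i j) (X i j)) ->
  ulead (\sum_i D i * al i) (mxev v p) (mxeval polyC X p).
Proof.
move=> Dp GX.
apply: (@mxeval_graded F k m _ polyC (fun a _ => ulead a) _ _ _ _ _
  D p v X al al Dp GX).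
- by move=> a _; rewrite /ulead size_poly0 coef0.
- by rewrite /ulead size_poly1 coef1.
- move=> a _ c c' q q' [qa <-] [q'a <-]; split; last by rewrite coefD.
  by rewrite (leq_trans (size_polyD _ _)) // geq_max qa.
- move=> a _ e c q [qa <-]; split; last by rewrite coefCM.
  by rewrite mul_polyC (leq_trans (size_scale_leq _ _)).
move=> a _ a' _ c c' q q' [qa <-] [q'a <-]; split; last exact: coefM_top.
by rewrite (leq_trans (size_polyMleq _ _)) //; lia.
Qed.

(* The rows are X_i = (1 + be i * e * t) v_i up to t^2. *)
Lemma mxeval_first_order (X : 'M[{poly F}]_(k, m)) v p D e (be : 'I_k -> nat) :
  multihom D p ->
  (forall i j, (X i j)`_0 = v i j /\ (X i j)`_1 = e * v i j *+ be i) ->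
  (mxeval polyC X p)`_0 = mxev v p /\
  (mxeval polyC X p)`_1 = e * mxev v p *+ (\sum_i D i * be i)%N.
Proof.
move=> Dp GX.
apply: (@mxeval_graded F k m _ polyC
  (fun _ b c q => q`_0 = c /\ q`_1 = e * c *+ b) _ _ _ _ _ D p v X be be Dp GX).
- by move=> _ b; rewrite !coef0 mulr0 mul0rn.
- by rewrite !coef1 mulr0n.
- by move=> _ b c c' q q' [<- q1] [<- q'1]; rewrite !coefD q1 q'1 mulrDr mulrnDl.
- by move=> _ b a c q [<- q1]; rewrite !coefCM q1 mulrnAr mulrCA.
move=> _ b _ b' c c' q q' [<- q1] [<- q'1]; rewrite !coefM !big_ord_recl !big_ord0.
split; first by rewrite addr0.
rewrite /= !addr0 q1 q'1 mulrnDr !mulrnAr !mulrnAl; ring.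
Qed.
End Substitution.

(** * Products of coordinate subspaces *)

(** [g] is the gradient of [p] at [v]. Functions of [y] with constant term independent of [y] and
    first-order term linear in [y] are closed under sums and products. *)
Lemma mxeval_gradient (F : fieldType) (k m : nat) (v : 'M[F]_(k, m))
    (p : {mpoly F[k * m]}) :
  exists g : 'M[F]_(k, m), forall y : 'M[F]_(k, m),
  (mxeval polyC (\matrix_(i, j) ((v i j)%:P + (y i j) *: 'X)) p)`_1 =
  \sum_i \sum_j y i j * g i j.
Proof.
pose V (y : 'M[F]_(k, m)) : 'M[{poly F}]_(k, m) :=
  \matrix_(i, j) ((v i j)%:P + (y i j) *: 'X).
pose T (q : 'M[F]_(k, m) -> {poly F}) := exists c (g : 'M[F]_(k, m)),
  forall y, (q y)`_0 = c /\ (q y)`_1 = \sum_i \sum_j y i j * g i j.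
have sum0 (y : 'M[F]_(k, m)) : \sum_i \sum_j y i j * (0 : 'M[F]_(k, m)) i j = 0.
  by rewrite big1 // => i _; rewrite big1 // => j _; rewrite mxE mulr0.
have TC c : T (fun=> c%:P) by exists c, 0 => y; rewrite !coefC sum0.
have TD q q' : T q -> T q' -> T (fun y => q y + q' y).
  case=> c [g qE] [c' [g' q'E]]; exists (c + c'), (g + g') => y.
  rewrite !coefD !(proj1 (qE y)) !(proj1 (q'E y)) (proj2 (qE y)) (proj2 (q'E y)).
  split=> //; rewrite -big_split; apply: eq_bigr => i _.
  by rewrite -big_split; apply: eq_bigr => j _; rewrite mxE mulrDr.
have TM q q' : T q -> T q' -> T (fun y => q y * q' y).
  case=> c [g qE] [c' [g' q'E]]; exists (c * c'), (c *: g' + c' *: g) => y.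
  rewrite !coefM !big_ord_recl !big_ord0 /= /bump /= !addr0.
  rewrite !(proj1 (qE y)) !(proj1 (q'E y)) (proj2 (qE y)) (proj2 (q'E y)).
  split=> //; rewrite mulr_sumr mulr_suml -big_split; apply: eq_bigr => i _.
  rewrite mulr_sumr mulr_suml -big_split; apply: eq_bigr => j _ /=.
  by rewrite !mxE; ring.
have TX i j : T (fun y => V y i j).
  exists (v i j), (delta_mx i j) => y; rewrite !mxE !coefD !coefC !coefZ !coefX.
  rewrite !mulr0 mulr1 addr0 add0r; split=> //.
  rewrite (bigD1 i) //= (bigD1 j) //= mxE !eqxx mulr1.
  rewrite !big1 ?addr0 // => [i' /negPf i'i|j' /negPf j'j].
    by rewrite big1 // => j' _; rewrite mxE i'i mulr0.
  by rewrite mxE j'j andbF mulr0.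
have Tprod (I : Type) (r : seq I) (q : I -> 'M[F]_(k, m) -> {poly F}) :
    (forall i, T (q i)) -> T (fun y => \prod_(i <- r) q i y).
  move=> Tq; elim: r => [|i r [c [g IHr]]].
    by have [c [g H]] := TC 1; exists c, g => y; rewrite big_nil.
  have [c' [g' H]] := TM _ _ (Tq i) (ex_intro _ c (ex_intro _ g IHr)).
  by exists c', g' => y; rewrite big_cons.
have Texp q n : T q -> T (fun y => q y ^+ n).
  move=> Tq; elim: n => [|n [c [g IHn]]].
    by have [c [g H]] := TC 1; exists c, g => y; rewrite expr0.
  have [c' [g' H]] := TM _ _ Tq (ex_intro _ c (ex_intro _ g IHn)).
  by exists c', g' => y; rewrite exprS.
suff [c [g H]] : T (fun y => mxeval polyC (V y) p) by exists g => y; have [] := H y.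
have [c [g H]] : T (fun y => \sum_(mm <- msupp p) (p@_mm)%:P *
    \prod_i \prod_j V y i j ^+ mm (mxvec_index i j)).
  elim: (msupp p) => [|mm r [c [g IHr]]].
    by have [c [g H]] := TC 0; exists c, g => y; rewrite big_nil.
  have Tm : T (fun y => (p@_mm)%:P * \prod_i \prod_j V y i j ^+ mm (mxvec_index i j)).
    by apply: (TM) => //; do 2!apply: (Tprod) => ?; apply: (Texp).
  have [c' [g' H]] := TD _ _ Tm (ex_intro _ c (ex_intro _ g IHr)).
  by exists c', g' => y; rewrite big_cons.
by exists c, g => y; rewrite mxevalE.
Qed.

Section Box.
Variables (F : closedFieldType).

(** Homogeneous coordinates of a point of the product of the coordinate subspaces [P(S i)]. *)
Definition boxed (k m : nat) (S : 'I_k -> {set 'I_m}) (v : 'M[F]_(k, m)) : Prop :=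
  forall i, (exists j, v i j != 0) /\ (forall j, v i j != 0 -> j \in S i).

(* [f] is a map from a product of coordinate subspaces to a projective space,
   given near each point by forms; the forms may vanish away from that point,
   but are proportional to [f] everywhere. *)
Definition regular_map (k m M : nat) (S : 'I_k -> {set 'I_m})
    (f : 'M[F]_(k, m) -> 'I_M -> F) : Prop :=
  forall v, boxed S v -> exists D (P : 'I_M -> {mpoly F[k * m]}),
  [/\ forall c, multihom D (P c), exists c, mxev v (P c) != 0 &
      forall w, boxed S w -> colinear (fun c => mxev w (P c)) (f w)].

Definition mix (k m : nat) (T : {set 'I_k}) (y y' : 'M[F]_(k, m)) : 'M[F]_(k, m) :=
  \matrix_(i, j) if i \in T then y i j else y' i j.

Lemma boxed_mix (k m : nat) (S : 'I_k -> {set 'I_m}) T y y' :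
  boxed S y -> boxed S y' -> boxed S (mix T y y').
Proof.
move=> Sy Sy' i; have [[j yj] Sij] := Sy i; have [[j' y'j'] Sij'] := Sy' i.
split; first by case iT: (i \in T); [exists j | exists j']; rewrite mxE iT.
by move=> e; rewrite mxE; case: ifP => _; [exact: Sij | exact: Sij'].
Qed.

Definition line (k m : nat) (v w : 'M[F]_(k, m)) (t : F) := v + t *: (w - v).

Definition line_poly (k m : nat) (v w : 'M[F]_(k, m)) : 'M[{poly F}]_(k, m) :=
  \matrix_(i, j) ((v i j)%:P + (w i j - v i j) *: 'X).

Lemma line_polyE (k m : nat) (v w : 'M[F]_(k, m)) t :
  (\matrix_(i, j) (line_poly v w i j).[t]) = line v w t.
Proof. by apply/matrixP => i j; rewrite !mxE !hornerE mulrC. Qed.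

Lemma line0 (k m : nat) (v w : 'M[F]_(k, m)) : line v w 0 = v.
Proof. by rewrite /line scale0r addr0. Qed.

Lemma line1 (k m : nat) (v w : 'M[F]_(k, m)) : line v w 1 = w.
Proof. by rewrite /line scale1r addrC subrK. Qed.

Lemma line_rev (k m : nat) (v w : 'M[F]_(k, m)) t : line w v (1 - t) = line v w t.
Proof. by apply/matrixP => i j; rewrite !mxE; ring. Qed.

Section LineOpen.
Variables (k m : nat) (S : 'I_k -> {set 'I_m}).
Implicit Types (v w : 'M[F]_(k, m)) (O : 'M[F]_(k, m) -> Prop).

(** A substitute for Zariski openness, tested only on lines through a point of [O]. It suffices for
    irreducibility and suits sets defined by maps that have only local formulas. *)
Definition line_open O : Prop := forall v w, boxed S v -> boxed S w -> O v ->
  exists g : {poly F}, g.[0] != 0 /\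
  forall t, boxed S (line v w t) -> g.[t] != 0 -> O (line v w t).

Lemma line_boxed v w : boxed S v -> boxed S w ->
  exists g : {poly F}, g.[0] != 0 /\
  forall t, g.[t] != 0 -> boxed S (line v w t).
Proof.
move=> Sv Sw; have /fin_all_exists[a va] i : exists j, v i j != 0.
  by have [] := Sv i.
exists (\prod_i line_poly v w i (a i)); split.
  rewrite horner_prod; apply/prodf_neq0 => i _.
  by rewrite mxE !hornerE.
move=> t; rewrite horner_prod => /prodf_neq0 gt i; split.
  by exists (a i); rewrite -line_polyE mxE; exact: gt.
move=> j; rewrite !mxE; apply: contraNT => jS.
have [v0 w0] : v i j = 0 /\ w i j = 0.
  split; apply/eqP; apply: contraNT jS; first by have [_] := Sv i; apply.
  by have [_] := Sw i; apply.
by rewrite v0 w0 subrr mulr0 addr0.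
Qed.

Lemma line_open_and O O' :
  line_open O -> line_open O' -> line_open (fun v => O v /\ O' v).
Proof.
move=> oO oO' v w Sv Sw [Ov O'v].
have [g [g0 gO]] := oO v w Sv Sw Ov; have [g' [g'0 gO']] := oO' v w Sv Sw O'v.
exists (g * g'); rewrite hornerM mulf_neq0 //; split=> // t St.
by rewrite hornerM mulf_eq0 => /norP[gt g't]; split; [exact: gO | exact: gO'].
Qed.

(* Two such sets always meet: this is the irreducibility of a product of
   coordinate subspaces. *)
Lemma line_open_meet O O' v w :
  line_open O -> line_open O' -> boxed S v -> boxed S w -> O v -> O' w ->
  exists u, [/\ boxed S u, O u & O' u].
Proof.
move=> oO oO' Sv Sw Ov O'w.
have [g [g0 gO]] := oO v w Sv Sw Ov; have [g' [g'0 gO']] := oO' w v Sw Sv O'w.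
have [h [h0 hS]] := line_boxed Sv Sw.
(* [g'] is parametrised from [w] towards [v], hence the substitution of [1 - 'X]. *)
have /closed_nonrootP[t] : g * (g' \Po (1 - 'X)) * h != 0.
  rewrite !mulf_neq0 //.
  - by apply: contraNneq g0 => ->; rewrite horner0.
  - apply: contraNneq g'0 => /(congr1 (fun p => p.[1])).
    by rewrite horner_comp !hornerE subrr => ->.
  by apply: contraNneq h0 => ->; rewrite horner0.
rewrite /root !hornerM horner_comp !hornerE !mulf_eq0 !negb_or.
case/andP=> /andP[gt g't] /hS St; exists (line v w t); split=> //; first exact: gO.
by rewrite -line_rev; apply: gO'; rewrite ?line_rev.
Qed.

Lemma line_open_row (b : 'M[F]_(k, m)) j :
  line_open (fun v => ~ colinear (v j) (b j)).
Proof.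
move=> v w Sv Sw /not_all_ex_not[c /not_all_ex_not[c' vb]].
pose g := line_poly v w j c * (b j c')%:P - line_poly v w j c' * (b j c)%:P.
have gE t : g.[t] = line v w t j c * b j c' - line v w t j c' * b j c.
  by rewrite /g /line !mxE !hornerE; ring.
exists g; split; first by rewrite gE line0 subr_eq0; apply/eqP.
by move=> t _; rewrite gE => gt H; move/eqP: gt; apply; rewrite H subrr.
Qed.
End LineOpen.
End Box.

(** * Factoring a coordinate through one component *)

Lemma colinear_scalel (R : comNzRingType) (I : Type) (u v w : I -> R) e :
  (forall c, u c = e * v c) -> colinear v w -> colinear u w.
Proof. by move=> uE vw a b; rewrite !uE -!mulrA vw. Qed.

Lemma colinear_refl (R : comNzRingType) (I : Type) (u : I -> R) : colinear u u.
Proof. by move=> a b; rewrite mulrC. Qed.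

Section Factor.
Variables (F : closedFieldType) (k m : nat) (S : 'I_k -> {set 'I_m}).
Variables (k' m' : nat) (S' : 'I_k' -> {set 'I_m'}).
Variable phi : 'M[F]_(k, m) -> 'M[F]_(k', m').
Hypothesis phi_boxed : forall v, boxed S v -> boxed S' (phi v).
Hypothesis phi_regular : forall i, regular_map S (fun v => phi v i).
Variables (y0 : 'M[F]_(k', m')).
Hypothesis y0_boxed : boxed S' y0.

Lemma phi_forms v : boxed S v ->
  exists (D : 'I_k' -> 'I_k -> nat) (P : 'I_k' -> 'I_m' -> {mpoly F[k * m]}),
  forall i, [/\ forall c, multihom (D i) (P i c), exists c, mxev v (P i c) != 0 &
    forall w, boxed S w -> colinear (fun c => mxev w (P i c)) (phi w i)].
Proof.
move=> Sv; have /fin_all_exists[D DP] i := phi_regular i Sv.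
have /fin_all_exists[P PE] i := DP i.
by exists D, P.
Qed.

Section OneMap.
Variables (M : nat) (psi : 'M[F]_(k', m') -> 'I_M -> F).
Hypothesis psi_regular : regular_map S' psi.

(** The composite of the forms of [phi] and [psi] at [v] is not zero at parameter 0; elsewhere it
    may vanish but stays proportional to the map. *)
Lemma mix_along_line (U : {set 'I_k'}) v w : boxed S v -> boxed S w ->
  exists R : 'I_M -> {poly F}, (exists c, (R c).[0] != 0) /\
  forall t, boxed S (line v w t) ->
    colinear (fun c => (R c).[t]) (psi (mix U (phi (line v w t)) y0)).
Proof.
move=> Sv Sw; have [D [P DP]] := phi_forms Sv.
have Smix u : boxed S u -> boxed S' (mix U (phi u) y0).
  by move=> Su; apply: boxed_mix => //; exact: phi_boxed.
have [E [Q [EQ [c0 Qc0] Qpsi]]] := psi_regular (Smix v Sv).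
pose Y : 'M[{poly F}]_(k', m') := \matrix_(i, c)
  if i \in U then mxeval polyC (line_poly v w) (P i c) else (y0 i c)%:P.
pose Yt t : 'M[F]_(k', m') := \matrix_(i, c)
  if i \in U then mxev (line v w t) (P i c) else y0 i c.
have RE t c : (mxeval polyC Y (Q c)).[t] = mxev (Yt t) (Q c).
  rewrite mxev_horner; congr mxev; apply/matrixP => i j; rewrite !mxE.
  by case: ifP => _; rewrite ?hornerC // mxev_horner line_polyE.
have col t : boxed S (line v w t) ->
    forall i, colinear (Yt t i) (mix U (phi (line v w t)) y0 i).
  move=> St i a b; rewrite !mxE; case: ifP => _; last exact: mulrC.
  by have [_ _ /(_ _ St)] := DP i; exact.
exists (fun c => mxeval polyC Y (Q c)); split.
  exists c0; rewrite RE.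
  have S0 : boxed S (line v w 0) by rewrite line0.
  have [e eE] := mxev_row_colinear EQ (fun i => proj1 (Smix _ S0 i)) (col 0 S0).
  rewrite eE line0 => e0; rewrite mulf_neq0 //; apply: e0 => i.
  case iU: (i \in U).
    by have [_ [c Pc] _] := DP i; exists c; rewrite mxE iU line0.
  by have [[c yc] _] := y0_boxed i; exists c; rewrite mxE iU.
move=> t St.
have [e eE _] := mxev_row_colinear EQ (fun i => proj1 (Smix _ St i)) (col t St).
apply: (colinear_scalel (v := fun c => mxev (mix U (phi (line v w t)) y0) (Q c)) (e := e)).
  by move=> c; rewrite RE eE.
by apply: Qpsi; exact: Smix.
Qed.

End OneMap.

Section Line.
Variables (psi : 'M[F]_(k', m') -> 'I_m -> F).
Hypothesis psi_neq0 : forall y, boxed S' y -> exists c, psi y c != 0.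
Hypothesis psi_regular : regular_map S' psi.
Variables (b : 'M[F]_(k, m)) (j0 : 'I_k).
Hypothesis b_boxed : boxed S b.
Hypothesis b_phi : phi b = y0.
Hypothesis phi_rowscale : forall v w, boxed S v -> boxed S w ->
  (forall i, colinear (v i) (w i)) -> phi v = phi w.

Lemma line_open_mix (U : {set 'I_k'}) :
  line_open S (fun v => ~ colinear (psi (mix U (phi v) y0)) (v j0)).
Proof.
move=> v w Sv Sw nv; have [R [[c0 Rc0] Rpsi]] := mix_along_line psi_regular U Sv Sw.
have S0 : boxed S (line v w 0) by rewrite line0.
have /not_all_ex_not[c /not_all_ex_not[c' Rcc']] :
    ~ colinear (fun c => (R c).[0]) (v j0).
  move=> H; apply: nv; have := colinear_sym (Rpsi 0 S0); rewrite line0 => H'.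
  exact: (colinear_trans (v := fun c => (R c).[0]) (c := c0)).
pose g := R c * line_poly v w j0 c'
          - R c' * line_poly v w j0 c.
have gE t : g.[t] = (R c).[t] * line v w t j0 c'
                    - (R c').[t] * line v w t j0 c.
  by rewrite /g /line !mxE !hornerE; ring.
exists g; split; first by rewrite gE line0 subr_eq0; apply/eqP.
move=> t St; rewrite gE => gt H; move/eqP: gt; apply.
have [e pe] : exists e, psi (mix U (phi (line v w t)) y0) e != 0.
  by apply: psi_neq0; apply: boxed_mix => //; exact: phi_boxed.
by have -> := colinear_trans pe (Rpsi t St) H c c'; rewrite subrr.
Qed.
(* On the line from b to v the two variables t and t' move the i-th component
   and the other components in T.  Rows of v and b are equal or independent, so
   no row of the line vanishes; w is its point at infinity. *)
Lemma mix_dichotomy_normal (T : {set 'I_k'}) i v : boxed S v -> i \in T ->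
  (forall u, boxed S u -> colinear (psi (mix T (phi u) y0)) (u j0)) ->
  (forall l, (forall c, v l c = b l c) \/ ~ colinear (v l) (b l)) ->
  ~ colinear (v j0) (b j0) ->
  colinear (psi (mix [set i] (phi v) y0)) (v j0) \/
  colinear (psi (mix (T :\ i) (phi v) y0)) (v j0).
Proof.
move=> Sv iT GT normv vbj0.
pose u : 'M[F]_(k, m) := v - b.
(* [d l] is the degree of row [l] along the line, and [w] collects the leading coefficients. *)
pose d l : nat := [exists c, u l c != 0].
pose w : 'M[F]_(k, m) := \matrix_(l, c) if [exists c, u l c != 0] then u l c else b l c.
have uE l c : u l c = v l c - b l c by rewrite !mxE.
have ncol l : [exists c, u l c != 0] -> ~ colinear (v l) (b l).
  case/existsP=> c uc; case: (normv l) => // vb.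
  by case/eqP: uc; rewrite uE vb subrr.
have usup l c : u l c != 0 -> c \in S l.
  rewrite uE; apply: contraNT => cS.
  have /eqP-> : v l c == 0 by apply: contraNT cS; have [_] := Sv l; exact.
  have /eqP-> : b l c == 0 by apply: contraNT cS; have [_] := b_boxed l; exact.
  by rewrite subrr.
have Sw : boxed S w.
  move=> l; case ul: [exists c, u l c != 0]; last first.
    have [[c bc] Sb] := b_boxed l; split; first by exists c; rewrite mxE ul.
    by move=> e; rewrite mxE ul; exact: Sb.
  have /existsP[c uc] := ul; split; first by exists c; rewrite mxE ul.
  by move=> e; rewrite mxE ul; exact: usup.
pose gam := line b v.
have gamE t l c : gam t l c = b l c + t * u l c by rewrite /gam /line !mxE.
(* A row with [v l] equal to [b l] is constant, and no affine combination of independent rows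
   vanishes. So local forms exist at every parameter. *)
have Sgam t : boxed S (gam t).
  move=> l; split; last first.
    move=> c; rewrite gamE; apply: contraNT => cS.
    have /eqP-> : b l c == 0 by apply: contraNT cS; have [_] := b_boxed l; exact.
    have /eqP-> : u l c == 0 by apply: contraNT cS; exact: usup.
    by rewrite mulr0 addr0.
  apply: NNPP => /not_ex_all_not g0.
  have {}g0 c : b l c + t * (v l c - b l c) = 0.
    by rewrite -uE -gamE; apply/eqP/negPn/negP; exact: g0.
  have [[c bc] _] := b_boxed l.
  have t0 : t != 0 by apply: contraNneq bc => t0; rewrite -(g0 c) t0 mul0r addr0.
  have [vb|] := normv l.
    by case/eqP: bc; rewrite -(g0 c) vb subrr mulr0 addr0.
  apply=> e e'; apply: (mulfI t0).
  have tv a : t * v l a = (t - 1) * b l a.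
    by apply/eqP; rewrite -subr_eq0 -[X in _ == X](g0 a); apply/eqP; ring.
  by rewrite !mulrA !tv; ring.
pose g : 'M[{poly F}]_(k, m) := line_poly b v.
have g_lead l c : ulead (d l) (w l c) (g l c).
  rewrite /ulead /g !mxE -uE /d; case ul: [exists c, u l c != 0] => /=.
    split; last by rewrite coefD coefC coefZ coefX add0r mulr1.
    rewrite (leq_trans (size_polyD _ _)) // geq_max.
    rewrite (leq_trans (size_polyC_leq1 _)) //=.
    by rewrite (leq_trans (size_scale_leq _ _)) // size_polyX.
  have /eqP u0 : u l c == 0 by apply: contraFT ul => uc; apply/existsP; exists c.
  by rewrite u0 scale0r addr0 size_polyC_leq1 coefC.
(* [^:P] puts the line parameter into the outer variable [t] (row [i]), [%:P] into the inner
   variable [t'] (the other rows in [T]). *)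
pose Y (P P' : 'I_k' -> 'I_m' -> {mpoly F[k * m]}) : 'M[{poly {poly F}}]_(k', m') :=
  \matrix_(i', c) if i' == i then (mxeval polyC g (P i' c))^:P
   else if i' \in T then (mxeval polyC g (P' i' c))%:P else (y0 i' c)%:P%:P.
pose mix3 y y' := mix [set i] y (mix T y' y0).
have Smix3 y y' : boxed S' y -> boxed S' y' -> boxed S' (mix3 y y').
  by move=> Sy Sy'; do !apply: boxed_mix.
pose Z v1 v2 (P P' : 'I_k' -> 'I_m' -> {mpoly F[k * m]}) : 'M[F]_(k', m') :=
  \matrix_(i', c) if i' == i then mxev v1 (P i' c)
   else if i' \in T then mxev v2 (P' i' c) else y0 i' c.
have YZ P P' t t' q : (mxeval (polyCC F) (Y P P') q).[t, t'] =
    mxev (Z (gam t) (gam t') P P') q.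
  rewrite mxev_horner2; congr mxev; apply/matrixP => i' c; rewrite !mxE.
  case: ifP => _; last case: ifP => _; last by rewrite !hornerC.
    by rewrite -horner2_swapXY swapXY_map_polyC !hornerC mxev_horner line_polyE.
  by rewrite !hornerC mxev_horner line_polyE.
pose forms v1 (D : 'I_k' -> 'I_k -> nat) P :=
  forall i', [/\ forall c, multihom (D i') (P i' c),
      exists c : 'I_m', mxev v1 (P i' c) != 0 &
      forall w, boxed S w -> colinear (fun c => mxev w (P i' c)) (phi w i')].
have Zcol v1 v2 w1 w2 D D' P P' : forms v1 D P -> forms v2 D' P' ->
    boxed S w1 -> boxed S w2 ->
    forall i', colinear (Z w1 w2 P P' i') (mix3 (phi w1) (phi w2) i').
  move=> fP fP' S1 S2 i' a a'; rewrite !mxE inE.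
  case: ifP => _; first by have [_ _] := fP i'; exact.
  by case: ifP => _; [have [_ _] := fP' i'; exact | exact: mulrC].
have Zneq0 v1 v2 D D' P P' : forms v1 D P -> forms v2 D' P' ->
    forall i', exists c, Z v1 v2 P P' i' c != 0.
  move=> fP fP' i'; case ii: (i' == i).
    by have [_ [c Pc] _] := fP i'; exists c; rewrite mxE ii.
  case i'T: (i' \in T).
    by have [_ [c Pc] _] := fP' i'; exists c; rewrite mxE ii i'T.
  by have [[c yc] _] := y0_boxed i'; exists c; rewrite mxE ii i'T.
pose Psi t t' := psi (mix3 (phi (gam t)) (phi (gam t'))).
have rep v1 v2 D D' P P' E Q : forms v1 D P -> forms v2 D' P' ->
    (forall c, multihom E (Q c)) ->
    (forall y, boxed S' y -> colinear (fun c => mxev y (Q c)) (psi y)) ->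
    forall t t', colinear (fun c => (mxeval (polyCC F) (Y P P') (Q c)).[t, t'])
      (Psi t t').
  move=> fP fP' EQ Qpsi t t'.
  have Sm := Smix3 _ _ (phi_boxed (Sgam t)) (phi_boxed (Sgam t')).
  have [e eE _] := mxev_row_colinear EQ (fun i' => proj1 (Sm i'))
    (Zcol _ _ _ _ _ _ _ _ fP fP' (Sgam t) (Sgam t')).
  apply: colinear_scalel (Qpsi _ Sm) => c.
  by rewrite YZ eE.
have nz v1 v2 D D' P P' E Q c : boxed S v1 -> boxed S v2 ->
    forms v1 D P -> forms v2 D' P' -> (forall c, multihom E (Q c)) ->
    mxev (mix3 (phi v1) (phi v2)) (Q c : {mpoly F[k' * m']}) != 0 ->
    exists c : 'I_m, mxev (Z v1 v2 P P') (Q c) != 0.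
  move=> S1 S2 fP fP' EQ Qc; exists c.
  have Sm := Smix3 _ _ (phi_boxed S1) (phi_boxed S2).
  have [e -> e0] := mxev_row_colinear EQ (fun i' => proj1 (Sm i'))
    (Zcol _ _ _ _ _ _ _ _ fP fP' S1 S2).
  by rewrite mulf_neq0 //; apply: e0; exact: Zneq0 fP fP'.
have lineE t : (fun c => b j0 c + t * u j0 c) =1 gam t j0 by move=> c; rewrite gamE.
have mixT y : mix3 y y = mix T y y0.
  apply/matrixP => i' c; rewrite !mxE inE.
  by case: eqP => [->|//]; rewrite iT.
have [||||| HX | HX] := @bivariate_line F m Psi (b j0) (u j0).
- by move=> t t'; apply: psi_neq0; apply: Smix3; apply: phi_boxed.
- move=> t a a'; rewrite !lineE /Psi mixT; exact: GT.
- move=> H; apply: vbj0 => a a'.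
  have h := H a a'; rewrite !uE in h; apply/eqP; rewrite -subr_eq0.
  have -> : v j0 a * b j0 a' - v j0 a' * b j0 a =
    b j0 a' * (v j0 a - b j0 a) - b j0 a * (v j0 a' - b j0 a') by ring.
  by rewrite h subrr.
- move=> t0 t0'.
  have [D [P fP]] := phi_forms (Sgam t0); have [D' [P' fP']] := phi_forms (Sgam t0').
  have Sm := Smix3 _ _ (phi_boxed (Sgam t0)) (phi_boxed (Sgam t0')).
  have [E [Q [EQ [c Qc] Qpsi]]] := psi_regular Sm.
  exists (fun c => mxeval (polyCC F) (Y P P') (Q c)); last exact: rep fP fP' EQ Qpsi.
  have [e Qe] := nz _ _ _ _ _ _ _ _ _ (Sgam t0) (Sgam t0') fP fP' EQ Qc.
  by exists e; rewrite YZ.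
(* The forms are now taken at the point at infinity. Row [i'] of [Y] has formal degree [N i'] in its
   variable, and the extreme coefficient of the composite is its value at [w], which is non-zero for
   some entry. *)
- have [D [P fP]] := phi_forms Sw.
  have Sm := Smix3 _ _ (phi_boxed Sw) (phi_boxed Sw).
  have [E [Q [EQ [c Qc] Qpsi]]] := psi_regular Sm.
  exists (fun c => mxeval (polyCC F) (Y P P) (Q c)).
  pose N i' := (\sum_l D i' l * d l)%N.
  exists (\sum_i' E i' * (if i' == i then N i' else 0))%N.
  exists (\sum_i' E i' * (if (i' != i) && (i' \in T) then N i' else 0))%N.
  have bl c' := @mxeval_bilead F k' m' (Y P P) (Z w w P P) (Q c') E
    (fun i' => if i' == i then N i' else 0)%N
    (fun i' => if (i' != i) && (i' \in T) then N i' else 0)%N (EQ c').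
  have {}bl c' : bilead (\sum_i' E i' * (if i' == i then N i' else 0))%N
    (\sum_i' E i' * (if (i' != i) && (i' \in T) then N i' else 0))%N
    (mxev (Z w w P P) (Q c')) (mxeval (polyCC F) (Y P P) (Q c')).
    apply: bl => i' e; rewrite !mxE.
    have [DP _ _] := fP i'; have [sz co] := mxeval_ulead (DP e) g_lead.
    case: ifP => _ /=.
      split; first by rewrite size_map_polyC.
        by rewrite sizeYE swapXY_map_polyC size_polyC_leq1.
      by rewrite coef_map coefC.
    case: ifP => _ /=.
      split; first exact: size_polyC_leq1.
        by rewrite sizeYE swapXY_polyC size_map_polyC.
      by rewrite coefC.
    split; first exact: size_polyC_leq1.
      by rewrite sizeYE swapXY_polyC map_polyC size_polyC_leq1.
    by rewrite !coefC.
  split; [by move=> c'; have [] := bl c' | by move=> c'; have [] := bl c' | |].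
    have [e Qe] := nz w w D D P P E Q c Sw Sw fP fP EQ Qc.
    by exists e; have [_ _ ->] := bl e.
  exact: (rep w w D D P P E Q).
(* At [t = 1], [t' = 0] row [i] comes from [v] and the rest from [b], where [phi b = y0]; the other
   alternative is read at [(0, 1)]. *)
- left; have := HX 1 0.
  rewrite /Psi /gam line0 line1 b_phi => H a a'.
  have := H a a'; rewrite !lineE /gam line1.
  suff -> : mix3 (phi v) y0 = mix [set i] (phi v) y0 by [].
  by apply/matrixP => i' c; rewrite !mxE; case: ifP => //; case: ifP.
right; have := HX 0 1.
rewrite /Psi /gam line0 line1 b_phi => H a a'.
have := H a a'; rewrite !lineE /gam line1.
suff -> : mix3 y0 (phi v) = mix (T :\ i) (phi v) y0 by [].
by apply/matrixP => i' c; rewrite !mxE !inE; case: eqP.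
Qed.

(** Rows of [v] proportional to those of [b] can be replaced by the latter, since [phi_rowscale]
    leaves [phi v] unchanged. *)
Lemma mix_dichotomy (T : {set 'I_k'}) i v : boxed S v -> i \in T ->
  (forall u, boxed S u -> colinear (psi (mix T (phi u) y0)) (u j0)) ->
  ~ colinear (v j0) (b j0) ->
  colinear (psi (mix [set i] (phi v) y0)) (v j0) \/
  colinear (psi (mix (T :\ i) (phi v) y0)) (v j0).
Proof.
move=> Sv iT GT vb.
pose col l := [forall a, forall a', v l a * b l a' == v l a' * b l a].
have colP l : reflect (colinear (v l) (b l)) (col l).
  by apply: (iffP 'forall_'forall_eqP).
pose v' : 'M[F]_(k, m) := \matrix_(l, c) if col l then b l c else v l c.
have v'v l : colinear (v' l) (v l).
  move=> a a'; rewrite !mxE; case: (colP l) => [H|_]; last exact: mulrC.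
  by rewrite mulrC -H mulrC.
have v'j0 : v' j0 =1 v j0 by move=> c; rewrite mxE; case: (colP j0).
have Sv' : boxed S v'.
  move=> l; case cl: (col l).
    have [[c bc] bS] := b_boxed l.
    by split=> [|e]; [exists c|]; rewrite mxE cl //; exact: bS.
  have [[c bc] bS] := Sv l.
  by split=> [|e]; [exists c|]; rewrite mxE cl //; exact: bS.
have phiE := phi_rowscale Sv' Sv v'v.
have [] := @mix_dichotomy_normal T i v' Sv' iT GT.
- move=> l; case: (colP l) => [H|H]; first by left=> c; rewrite mxE (introT (colP l) H).
  by right=> H'; apply: (H) => a a'; have := H' a a'; rewrite !mxE (introF (colP l) H).
- by move=> H; apply: vb => a a'; rewrite -!v'j0.
- by rewrite phiE => H; left=> a a'; rewrite -!v'j0.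
by rewrite phiE => H; right=> a a'; rewrite -!v'j0.
Qed.

Hypothesis psi_phi : forall v, boxed S v -> colinear (psi (phi v)) (v j0).
Hypothesis j0_moves : exists2 v, boxed S v & ~ colinear (v j0) (b j0).

(** The dichotomy holds point by point. If each alternative failed somewhere, the two failure sets
    and the set where row [j0] moves, all line-open, would share a point. *)
Lemma mix_split (T : {set 'I_k'}) i : i \in T ->
  (forall u, boxed S u -> colinear (psi (mix T (phi u) y0)) (u j0)) ->
  (forall u, boxed S u -> colinear (psi (mix [set i] (phi u) y0)) (u j0)) \/
  (forall u, boxed S u -> colinear (psi (mix (T :\ i) (phi u) y0)) (u j0)).
Proof.
move=> iT GT.
have oM := line_open_mix.
apply: NNPP => /not_or_and[/not_all_ex_not[v1 n1] /not_all_ex_not[v2 n2]].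
have [Sv1 {}n1] := imply_to_and _ _ n1; have [Sv2 {}n2] := imply_to_and _ _ n2.
have [v3 Sv3 n3] := j0_moves.
have [v [Sv nv1 nv2]] := line_open_meet (oM _) (oM _) Sv1 Sv2 n1 n2.
have [v' [Sv' [nv1' nv2'] nv3']] := line_open_meet (line_open_and (oM _) (oM _))
  (@line_open_row F k m S b j0) Sv Sv3 (conj nv1 nv2) n3.
by case: (mix_dichotomy Sv' iT GT nv3').
Qed.

(** Indices are removed from [T] as long as the rest still recovers row [j0]. [T] cannot become
    empty: [psi] would be constant although row [j0] moves. *)
Lemma factor_through_one :
  exists i, forall u, boxed S u -> colinear (psi (mix [set i] (phi u) y0)) (u j0).
Proof.
suff: forall T : {set 'I_k'},
    (forall u, boxed S u -> colinear (psi (mix T (phi u) y0)) (u j0)) ->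
    exists i, forall u, boxed S u -> colinear (psi (mix [set i] (phi u) y0)) (u j0).
  move=> H; apply: (H setT) => u Su; suff -> : mix setT (phi u) y0 = phi u by exact: psi_phi.
  by apply/matrixP => i c; rewrite mxE inE.
move=> T; have [n] := ubnP #|T|; elim: n T => // n IHn T Tn GT.
have [T0|[i iT]] := set_0Vmem T; last first.
  have [|G] := mix_split iT GT; first by exists i.
  by apply: (IHn (T :\ i)) => //; move: Tn; rewrite (cardsD1 i) iT.
exfalso; have [v Sv vb] := j0_moves; apply: vb.
have E u : mix T u y0 = y0 by apply/matrixP => i c; rewrite mxE T0 inE.
have [c pc] := psi_neq0 y0_boxed.
have := GT v Sv; have := GT b b_boxed; rewrite !E => H1 H2.
by apply: colinear_trans pc (colinear_sym H2) H1.
Qed.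
End Line.
End Factor.

(** * Tangent spaces *)

Section Tangent.
Variables (F : closedFieldType) (k m : nat) (S : 'I_k -> {set 'I_m}).
Variables (k' m' : nat) (S' : 'I_k' -> {set 'I_m'}).
Variable phi : 'M[F]_(k, m) -> 'M[F]_(k', m').
Hypothesis phi_boxed : forall v, boxed S v -> boxed S' (phi v).
Variables (b : 'M[F]_(k, m)) (y0 : 'M[F]_(k', m')).
Hypothesis b_boxed : boxed S b.
Hypothesis y0_boxed : boxed S' y0.
Variables (i : 'I_k') (J : {set 'I_k}) (psi : 'I_k -> 'M[F]_(k', m') -> 'I_m -> F).
Hypothesis phi_regular : regular_map S (fun v => phi v i).
Hypothesis psi_neq0 : forall j, j \in J ->
  forall y, boxed S' y -> exists c, psi j y c != 0.
Hypothesis psi_regular : forall j, j \in J -> regular_map S' (psi j).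
Hypothesis psi_phi : forall j, j \in J -> forall v, boxed S v ->
  colinear (psi j (mix [set i] (phi v) y0)) (v j).

(* A tangent direction y at v0 moving only rows in J and killed by d(phi _ i)
   would be killed by d(psi j), although psi j recovers row j. *)
Lemma tangent_bound : (\sum_(j in J) #|S j|.-1 < #|S' i|)%N.
Proof.
have /fin_all_exists[a ba] j : exists c, b j c != 0 by have [] := b_boxed j.
have aS j : a j \in S j by have [_] := b_boxed j; apply.
(* At this coordinate point the tangent space of [P(S j)] has as coordinates the elements of [S j]
   other than [a j]; [Z] lists these for [j] in [J]. *)
pose v0 : 'M[F]_(k, m) := \matrix_(j, c) (c == a j)%:R.
pose Z := [set z : 'I_k * 'I_m | (z.1 \in J) && (z.2 \in S z.1 :\ a z.1)].
have cardZ : #|Z| = (\sum_(j in J) #|S j|.-1)%N.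
  rewrite -sum1_card; under [RHS]eq_bigr => j _.
    rewrite (_ : #|S j|.-1 = \sum_(c in S j :\ a j) 1)%N; last first.
      by rewrite sum1_card (cardsD1 (a j) (S j)) aS.
    over.
  by rewrite pair_big_dep; apply: eq_bigl => z; rewrite inE.
rewrite -cardZ ltnNge; apply/negP => leZ.
pose L (y : 'M[F]_(k, m)) : 'M[{poly F}]_(k, m) :=
  \matrix_(j, c) ((v0 j c)%:P + (y j c) *: 'X).
have Lt y t : (\matrix_(j, c) (L y j c).[t]) = v0 + t *: y.
  by apply/matrixP => j c; rewrite !mxE !hornerE mulrC.
have Svt (y : 'M[F]_(k, m)) t : (forall j c, (j, c) \notin Z -> y j c = 0) ->
    boxed S (v0 + t *: y).
  move=> yZ j; split=> [|c].
    by exists (a j); rewrite !mxE yZ ?inE /= ?eqxx ?andbF // mulr0 addr0 oner_eq0.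
  apply: contraNT => cS; rewrite !mxE yZ ?inE /= ?(negPf cS) ?andbF //.
  have -> : (c == a j) = false by apply: contraNF cS => /eqP->; exact: aS.
  by rewrite mulr0 addr0.
have Sv0 : boxed S v0.
  by have := @Svt 0 0 (fun j c _ => mxE _ _ j c); rewrite scaler0 addr0.
have [D [P [DP [c0 Pc0] Pphi]]] := phi_regular Sv0.
have /fin_all_exists[g gE] c := mxeval_gradient v0 (P c).
have Pout c (y : 'M[F]_(k, m)) : (forall j c, (j, c) \notin Z -> y j c = 0) ->
    c \notin S' i -> mxeval polyC (L y) (P c) = 0.
  move=> yZ cS; apply: poly_eq0_eval => t; rewrite mxev_horner Lt.
  have Sy := Svt y t yZ; have [[e pe] pS] := phi_boxed Sy i.
  apply: (mulIf pe); rewrite Pphi // mul0r.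
  suff /eqP -> : phi (v0 + t *: y) i c == 0 by rewrite mulr0.
  by apply: contraNT cS; exact: pS.
have P0 c y : (mxeval polyC (L y) (P c))`_0 = mxev v0 (P c).
  by rewrite -horner_coef0 mxev_horner Lt scale0r addr0.
(* The extra row is the value of the forms at [v0]: a direction is killed projectively when its
   derivative is a multiple of that value. With more rows than columns, such a direction exists. *)
pose N : 'M[F]_(#|Z| + 1, #|S' i|) := col_mx
  (\matrix_(r, s) g (enum_val s) (enum_val r).1 (enum_val r).2)
  (\matrix_(r, s) mxev v0 (P (enum_val s))).
have /rowV0Pn[u uN u0] : kermx N != 0.
  rewrite kermx_eq0; apply/negP => /eqP rN.
  by have := rank_leq_col N; rewrite rN addn1 leqNgt ltnS leZ.
have {uN} := sub_kermxP uN.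
rewrite -[u]hsubmxK mul_row_col => /rowP uN.
pose l := lsubmx u; pose e := - rsubmx u 0 0.
pose y : 'M[F]_(k, m) :=
  \matrix_(j, c) \sum_(r < #|Z|) l 0 r * ((j, c) == enum_val r)%:R.
have yZ j c : (j, c) \notin Z -> y j c = 0.
  move=> jcZ; rewrite mxE big1 // => r _; case: eqP => [jc|_]; last by rewrite mulr0.
  by case/negP: jcZ; rewrite jc enum_valP.
have yr r : y (enum_val r).1 (enum_val r).2 = l 0 r.
  rewrite mxE -surjective_pairing (bigD1 r) //= eqxx mulr1 big1 ?addr0 // => r' r'r.
  by rewrite (inj_eq enum_val_inj) eq_sym (negPf r'r) mulr0.
have dP c : (mxeval polyC (L y) (P c))`_1 = e * mxev v0 (P c).
  have [cS|cS] := boolP (c \in S' i); last first.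
    by rewrite -(P0 _ y) !Pout // !coef0 mulr0.
  rewrite gE; have := uN (enum_rank_in cS c); rewrite !mxE.
  rewrite big_ord1 [(\row_s _) _ _]mxE enum_rankK_in // => /eqP; rewrite addr_eq0 -mulNr => /eqP <-.
  transitivity (\sum_(z : 'I_k * 'I_m) y z.1 z.2 * g c z.1 z.2).
    by rewrite pair_bigA.
  rewrite (bigID (mem Z)) /= [X in _ + X]big1 ?addr0; last first.
    by case=> j c' jcZ; rewrite yZ // mul0r.
  rewrite big_enum_val; apply: eq_bigr => r _.
  by rewrite yr !mxE enum_rankK_in.
(* If the direction were zero, the one remaining kernel coefficient would multiply the non-zero
   value [mxev v0 (P c0)], so the kernel vector would be zero. *)
have [[j ay] jZ yj] : exists2 z, z \in Z & y z.1 z.2 != 0.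
  apply: NNPP => ny; case/negP: u0.
  have l0 : l = 0.
    apply/rowP => r; rewrite [RHS]mxE -yr; apply/eqP/negPn/negP => yr0.
    by apply: ny; exists (enum_val r) => //; exact: enum_valP.
  have c0S : c0 \in S' i.
    apply: contraNT Pc0 => cS; rewrite -(P0 _ 0) Pout ?coef0 //.
    by move=> *; rewrite mxE.
  have := uN (enum_rank_in c0S c0); rewrite -/l l0 mul0mx add0r !mxE.
  rewrite big_ord1 [(\row_s _) _ _]mxE enum_rankK_in // => /eqP.
  rewrite mulf_eq0 (negPf Pc0) orbF => /eqP r0.
  rewrite -[u]hsubmxK -/l l0 (_ : rsubmx u = 0) ?row_mx0 //.
  by apply/rowP => s; rewrite ord1 r0 mxE.
rewrite inE /= !inE in jZ; case/and3P: jZ => jJ aya ayS.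
have Sm : boxed S' (mix [set i] (phi v0) y0) by apply: boxed_mix => //; exact: phi_boxed.
have [E [Q [EQ [c1 Qc1] Qpsi]]] := psi_regular jJ Sm.
pose Y : 'M[{poly F}]_(k', m') := \matrix_(i', c)
  if i' == i then mxeval polyC (L y) (P c) else (y0 i' c)%:P.
pose Y0 : 'M[F]_(k', m') := \matrix_(i', c)
  if i' == i then mxev v0 (P c) else y0 i' c.
pose K c := mxeval polyC Y (Q c).
pose la c := mxev Y0 (Q c).
have K1 c : (K c)`_0 = la c /\ (K c)`_1 = e * la c *+ (\sum_i' E i' * (i' == i))%N.
  apply: (@mxeval_first_order _ _ _ Y Y0 (Q c) E e (fun i' => (i' == i) : nat) (EQ c)) => i' c'.
  rewrite [Y i' c']mxE [Y0 i' c']mxE.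
  have [_|_] := eqVneq i' i; first by rewrite P0 dP mulr1n.
  by rewrite !coefC mulr0n.
set n := (\sum_i' _)%N in K1.
have Kcol c c' : K c * L y j c' = K c' * L y j c.
  apply/eqP; rewrite -subr_eq0; apply/eqP; apply: poly_eq0_eval => t.
  have Sy := Svt y t yZ.
  have Sm' : boxed S' (mix [set i] (phi (v0 + t *: y)) y0).
    by apply: boxed_mix => //; exact: phi_boxed.
  pose Yt : 'M[F]_(k', m') := \matrix_(i', c)
    if i' == i then mxev (v0 + t *: y) (P c) else y0 i' c.
  have KE e' : (K e').[t] = mxev Yt (Q e').
    rewrite mxev_horner; congr mxev; apply/matrixP => i' s; rewrite !mxE.
    by case: ifP => _; rewrite ?hornerC // mxev_horner Lt.
  have Ycol i' : colinear (Yt i') (mix [set i] (phi (v0 + t *: y)) y0 i').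
    move=> s s'; rewrite !mxE inE; case: eqP => [->|_]; last exact: mulrC.
    exact: Pphi.
  have [f fE _] := mxev_row_colinear EQ (fun i' => proj1 (Sm' i')) Ycol.
  have [s ps] := psi_neq0 jJ Sm'.
  have Kpsi : colinear (fun c => (K c).[t]) (psi j (mix [set i] (phi (v0 + t *: y)) y0)).
    by apply: colinear_scalel (Qpsi _ Sm') => s'; rewrite KE fE.
  have LtE c2 : (L y j c2).[t] = (v0 + t *: y) j c2 by rewrite -Lt [RHS]mxE.
  have := colinear_trans ps Kpsi (psi_phi jJ Sy) c c'.
  by rewrite hornerD hornerN !hornerM !LtE => ->; rewrite subrr.
have [f fE f0] : exists2 f, (forall c, mxev Y0 (Q c) =
    f * mxev (mix [set i] (phi v0) y0) (Q c)) & f != 0.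
  have Ycol i' : colinear (Y0 i') (mix [set i] (phi v0) y0 i').
    move=> s s'; rewrite !mxE inE; case: eqP => [->|_]; last exact: mulrC.
    exact: Pphi.
  have [f fE f0] := mxev_row_colinear EQ (fun i' => proj1 (Sm i')) Ycol.
  exists f => //; apply: f0 => i'; case ii: (i' == i).
    by exists c0; rewrite mxE ii.
  by have [[c yc] _] := y0_boxed i'; exists c; rewrite mxE ii.
have lac1 : la c1 != 0 by rewrite /la fE mulf_neq0.
(* Comparing coefficients in [Kcol]: in degree 0, [la] is proportional to [v0 j], so it lives at
   [a j] alone; in degree 1, as the derivative of [K] is a multiple of [la], it is proportional to
   [y j], which is non-zero at [ay], another index. *)
have col0 c c' : la c * v0 j c' = la c' * v0 j c.
  have := congr1 (fun p : {poly F} => p`_0) (Kcol c c').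
  rewrite !coef0M !(proj1 (K1 _)) !mxE !coefD !coefC !coefZ !coefX /=.
  by rewrite !mulr0 !addr0.
have col1 c c' : la c * y j c' = la c' * y j c.
  have := congr1 (fun p : {poly F} => p`_1) (Kcol c c').
  rewrite !coefM !big_ord_recl !big_ord0 /= /bump /= !(proj1 (K1 _)) !(proj2 (K1 _)).
  rewrite ![L y j _]mxE !coefD !coefC !coefZ !coefX /= !mulr0 !mulr1 !addr0 !add0r.
  rewrite -[e * la c *+ n]mulr_natr -[e * la c' *+ n]mulr_natr => H.
  apply/eqP; rewrite -subr_eq0; apply/eqP; have C := col0 c c'.
  transitivity ((la c * y j c' + e * la c * n%:R * v0 j c') -
    (la c' * y j c + e * la c' * n%:R * v0 j c) -
    e * n%:R * (la c * v0 j c' - la c' * v0 j c)); first by ring.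
  by rewrite H C !subrr mulr0 subr0.
have laa c : c != a j -> la c = 0.
  by move=> ca; have := col0 c (a j); rewrite !mxE eqxx (negPf ca) mulr1 mulr0.
have laj : la (a j) != 0.
  by apply: contraNneq lac1 => la0; have [->|/laa->] := eqVneq c1 (a j); rewrite ?la0.
case/negP: yj; rewrite /= -(inj_eq (mulfI laj)) mulr0 col1 laa //.
by rewrite mul0r.
Qed.
End Tangent.

(** * Morphisms of point varieties *)

Lemma hcoord_neq0 (F : fieldType) (k m : nat) (x : multiproj F k m) i :
  exists c, hcoord x i c != 0.
Proof. by have /rV0Pn[c cx] := pcoord_neq0 (x i); exists c; rewrite mxE. Qed.

(** The affine coordinates [x_b / x_b0] pull back to local fractions, and a common denominator turns
    these into forms of one multidegree. *)
Lemma vmorphism_forms (F : fieldType) (V W : variety F) (f : vpt V -> vpt W) :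
  vmorphism f -> forall (x : vpt V) i, exists D (P : 'I_(v_var W) -> mpoly (v_fac V * v_var V) F),
  [/\ forall c, multihom D (P c), exists c, heval (P c) (sval x) != 0 &
    forall y : vpt V,
      colinear (fun c => heval (P c) (sval y)) (hcoord (sval (f y)) i)].
Proof.
move=> fmor x i; have [b0 xb0] := hcoord_neq0 (sval (f x)) i.
pose U (z : vpt W) := hcoord (sval z) i b0 != 0 : Prop.
have oU : zopen U.
  exists (fun p => p = 'X_(mxvec_index i b0)).
    by move=> _ ->; exists (fun i' => (i' == i : nat)); exact: multihomX.
  by move=> z; split=> [Uz|[_ ->]]; [exists 'X_(mxvec_index i b0)|]; rewrite ?hevalX.
have [[SU hSU fU] hU] := fmor U oU.
have [gU SgU gUx] : exists2 p, SU p & heval p (sval x) != 0 by apply/fU.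
have [DU DgU] := hSU _ SgU.
pose h b (z : vpt W) := hcoord (sval z) i b / hcoord (sval z) i b0.
have hreg b : regular_on U (h b).
  move=> z Uz; exists U; split=> //.
  exists (fun i' => (i' == i : nat)), 'X_(mxvec_index i b), 'X_(mxvec_index i b0).
  by split=> [||y Uy]; [exact: multihomX | exact: multihomX | rewrite !hevalX].
have loc b : exists Dg Dp (g p q : mpoly (v_fac V * v_var V) F),
    [/\ multihom Dg g, multihom Dp p, multihom Dp q, heval g (sval x) != 0 &
    forall y, heval g (sval y) != 0 -> heval q (sval y) != 0 /\
       h b (f y) = heval p (sval y) / heval q (sval y)].
  have [N [[SN hSN NE] Nx [Dp [p [q [pD qD pq]]]]]] := hU _ (hreg b) x xb0.
  have [g Sg gx] : exists2 g, SN g & heval g (sval x) != 0 by apply/NE.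
  have [Dg gD] := hSN _ Sg; exists Dg, Dp, g, p, q; split=> // y gy.
  by apply: pq; apply/NE; exists g.
have /fin_all_exists[Dg {}loc] := loc.
have /fin_all_exists[Dp {}loc] := loc.
have /fin_all_exists[g {}loc] := loc.
have /fin_all_exists[p {}loc] := loc.
have /fin_all_exists[q {}loc] := loc.
(* The factors [gU] and [g b'] make all the forms vanish where some local formula is not valid, so
   that proportionality holds on the whole variety. *)
pose P b := gU * \prod_b' (g b' * (if b' == b then p b' else q b')).
have PE b (y : vpt V) : heval (P b) (sval y) = heval gU (sval y) *
    \prod_b' (heval (g b') (sval y) *
       (if b' == b then heval (p b') (sval y) else heval (q b') (sval y))).
  rewrite /heval /P rmorphM rmorph_prod /=; congr (_ * _); apply: eq_bigr => b' _.
  by rewrite rmorphM /=; case: ifP.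
pose C (y : vpt V) := heval gU (sval y) *
    \prod_b' (heval (g b') (sval y) * heval (q b') (sval y)).
have PC b (y : vpt V) : hcoord (sval (f y)) i b0 != 0 ->
    (forall b', heval (g b') (sval y) != 0) -> heval (P b) (sval y) = C y * h b (f y).
  move=> fy gy; rewrite PE /C -mulrA; congr (_ * _).
  rewrite (bigD1 b) //= [in RHS](bigD1 b) //= eqxx.
  have [_ _ _ _ /(_ _ (gy b))[qy ->]] := loc b.
  rewrite (eq_bigr (fun b' => heval (g b') (sval y) * heval (q b') (sval y))); last first.
    by move=> b' /negPf ->.
  by rewrite [RHS]mulrAC mulrACA divff // !mulr1 -!mulrA; congr (_ * _); rewrite mulrA divfK.
exists (fun j => DU j + \sum_b' (Dg b' j + Dp b' j))%N, P; split.
- move=> b; apply: multihomM => //; apply: multihom_prod => b' _.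
  have [gD pD qD _ _] := loc b'; apply: multihomM => //.
  by case: ifP.
- exists b0; rewrite PC //; last by move=> b'; have [] := loc b'.
  rewrite /h divff // mulr1 mulf_neq0 //; apply/prodf_neq0 => b' _.
  have [_ _ _ gx /(_ _ gx)[qx _]] := loc b'; exact: mulf_neq0.
move=> y; have zero : (exists2 c, c = 0 & forall b, exists d, heval (P b) (sval y) = c * d) ->
    colinear (fun c => heval (P c) (sval y)) (hcoord (sval (f y)) i).
  move=> [_ -> Pd] b b'; have [d ->] := Pd b; have [d' ->] := Pd b'.
  by rewrite !mul0r.
have [gy|gy] := eqVneq (heval gU (sval y)) 0.
  by apply: zero; exists 0 => // b; rewrite PE gy; eexists.
case: (classic (exists b', heval (g b') (sval y) = 0)) => [[b' gb']|ngy].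
  apply: zero; exists 0 => // b; exists 0.
  by rewrite PE (bigD1 b') //= gb' !(mul0r, mulr0).
have fy : hcoord (sval (f y)) i b0 != 0 by apply/fU; exists gU.
apply: (@colinear_scalel _ _ _ (hcoord (sval (f y)) i) _
  (C y / hcoord (sval (f y)) i b0)); last exact: colinear_refl.
move=> b; rewrite PC //; last by move=> b'; apply/eqP => gb'; apply: ngy; exists b'.
by rewrite /h mulrA mulrAC.
Qed.

Lemma pcoord_eq_line (F : fieldType) (m : nat) (l : projspace F m) (u : 'rV[F]_m) :
  pline l = <[u]>%VS -> colinear (pcoord l 0) (u 0).
Proof.
move=> lu; have : pcoord l \in <[u]>%VS by rewrite -lu pcoord_line memv_line.
case/vlineP=> c -> a a'; rewrite !mxE; ring.
Qed.

Lemma projspace_eq (F : fieldType) (m : nat) (l l' : projspace F m) :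
  colinear (pcoord l 0) (pcoord l' 0) -> l = l'.
Proof.
move=> ll'; apply: val_inj; rewrite /= !pcoord_line.
have /rV0Pn[c l'c] := pcoord_neq0 l'.
have E : pcoord l = (pcoord l 0 c / pcoord l' 0 c) *: pcoord l'.
  by apply/rowP => a; rewrite mxE; exact: colinear_scale l'c ll' a.
apply/eqP; rewrite eqEdim !dim_vline !pcoord_neq0 andbT -memvE.
by rewrite {1}E memvZ // memv_line.
Qed.

Section BoxedVariety.
Variables (F : closedFieldType) (m : nat) (A : monalgebra F m).
Variable S : nat -> {set 'I_m}.
Hypothesis boxA : forall n (x : multiproj F n.+1 m),
  point_locus A x <-> forall i c, hcoord x i c != 0 -> c \in S i.
Variable s0 : nat -> 'I_m.
Hypothesis s0S : forall n, s0 n \in S n.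
Variable n : nat.

Definition Sn (i : 'I_n.+1) : {set 'I_m} := S i.

(* Rows that are zero or leave [S] are replaced by a coordinate point, so that
   every matrix defines a point of the variety. *)
Definition safe_row (v : 'M[F]_(n.+1, m)) (i : 'I_n.+1) : 'rV[F]_m :=
  if (row i v != 0) && [forall c, (v i c != 0) ==> (c \in S i)]
  then row i v else delta_mx 0 (s0 i).

Lemma safe_row_dim v i : \dim <[safe_row v i]> == 1%N.
Proof.
rewrite dim_vline /safe_row; case: ifP => [/andP[->]//|_].
suff -> : delta_mx 0 (s0 i) != 0 :> 'rV[F]_m by [].
by apply/rV0Pn; exists (s0 i); rewrite mxE !eqxx oner_eq0.
Qed.

Definition mx_multiproj (v : 'M[F]_(n.+1, m)) : multiproj F n.+1 m :=
  [ffun i => ProjSpace (safe_row_dim v i)].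

Lemma mx_multiproj_col v i : colinear (hcoord (mx_multiproj v) i) (safe_row v i 0).
Proof.
move=> c c'; rewrite !mxE ffunE.
exact: (@pcoord_eq_line _ _ (ProjSpace (safe_row_dim v i)) (safe_row v i) erefl).
Qed.

Lemma safe_rowE v i : boxed Sn v -> safe_row v i = row i v.
Proof.
move=> Sv; have [[c vc] vS] := Sv i; rewrite /safe_row.
suff -> : (row i v != 0) && [forall c, (v i c != 0) ==> (c \in S i)] by [].
apply/andP; split; first by apply/rV0Pn; exists c; rewrite mxE.
by apply/forallP => e; apply/implyP; exact: vS.
Qed.

Lemma hcoord_mx v i : boxed Sn v -> colinear (hcoord (mx_multiproj v) i) (v i).
Proof.
move=> Sv c c'; have := mx_multiproj_col v i c c'.
by rewrite (safe_rowE i Sv) [row i v 0 c]mxE [row i v 0 c']mxE.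
Qed.

Lemma mx_multiproj_locus v : point_locus A (mx_multiproj v).
Proof.
apply/boxA => i c xc; have vcol := mx_multiproj_col v i.
have [e ve] : exists e, safe_row v i 0 e != 0.
  by apply/rV0Pn; have := safe_row_dim v i; rewrite dim_vline eqb1.
have E := colinear_scale ve vcol c.
have {E} : safe_row v i 0 c != 0.
  by apply: contraNneq xc => v0; rewrite E v0 mulr0.
rewrite /safe_row; case: ifP => [/andP[_ /forallP/(_ c)/implyP]|_].
  by rewrite [row i v 0 c]mxE; apply.
rewrite mxE eqxx /=; have [-> _|_] := eqVneq c (s0 i); first exact: s0S.
by rewrite eqxx.
Qed.

Definition mx_pt v : vpt (point_variety A n) := exist _ _ (mx_multiproj_locus v).

Lemma boxed_hcoord (x : vpt (point_variety A n)) : boxed Sn (hcoord (sval x)).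
Proof.
move=> i; split; first exact: hcoord_neq0.
by move=> c; have /boxA := svalP x; apply.
Qed.

Lemma mx_pt_rowscale v w : boxed Sn v -> boxed Sn w ->
  (forall i, colinear (v i) (w i)) -> mx_multiproj v = mx_multiproj w.
Proof.
move=> Sv Sw vw; apply/ffunP => i; apply: projspace_eq => c c'.
have [[e ve] _] := Sv i; have [[e' we'] _] := Sw i.
have H := colinear_trans ve (hcoord_mx i Sv) (vw i).
by have := colinear_trans we' H (colinear_sym (hcoord_mx i Sw)) c c'; rewrite !mxE.
Qed.

Lemma regular_of_vmorphism (W : variety F) (f : vpt (point_variety A n) -> vpt W) i :
  vmorphism f -> regular_map Sn (fun v => hcoord (sval (f (mx_pt v))) i).
Proof.
move=> /vmorphism_forms fP v Sv; have [D [P [DP [c Pc] Pf]]] := fP (mx_pt v) i.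
have key w : boxed Sn w -> exists2 e, e != 0 & forall c,
    mxev w (P c) = e * heval (P c) (sval (mx_pt w)).
  move=> Sw; have [e eE e0] := mxev_row_colinear DP
    (hcoord_neq0 (mx_multiproj w)) (fun i' => colinear_sym (hcoord_mx i' Sw)).
  by exists e => //; apply: e0 => i'; have [] := Sw i'.
exists D, P; split=> //.
  by have [e e0 eE] := key v Sv; exists c; rewrite eE mulf_neq0.
move=> w Sw; have [e _ eE] := key w Sw.
exact: colinear_scalel eE (Pf _).
Qed.
End BoxedVariety.

Lemma pv_proj_addE (F : fieldType) (m : nat) (A : monalgebra F m) n k
    (x : vpt (point_provariety A (k + n)%N)) (i : 'I_n.+1) (i' : 'I_(k + n).+1) :
  i = i' :> nat -> sval (pv_proj_add (V := point_provariety A) x) i = sval x i'.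
Proof.
elim: k x i' => [|k IHk] x i' ii'; first by congr (sval x _); apply: val_inj.
have lti : (i < (k + n).+1)%N by rewrite ltnS (leq_trans _ (leq_addl _ _)) // -ltnS.
rewrite /= (IHk _ (Ordinal lti)) //= ffunE; congr (sval x _).
exact: val_inj.
Qed.

Lemma pv_downE (F : fieldType) (m : nat) (A : monalgebra F m) n n' (le_n : (n <= n')%N)
    (x : vpt (point_provariety A n')) (i : 'I_n.+1) (i' : 'I_n'.+1) :
  i = i' :> nat -> sval (pv_down le_n x) i = sval x i'.
Proof.
move=> ii'; rewrite /pv_down.
have lti : (i < (n' - n + n).+1)%N by rewrite subnK // ii'.
rewrite (@pv_proj_addE _ _ _ _ _ _ _ (Ordinal lti)) //.
move: lti; case: _ / (esym (subnK le_n)) => lti /=.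
by congr (sval x _); apply: val_inj.
Qed.

(** * Retractions between point provarieties *)

Lemma regular_map_ext (F : closedFieldType) (k m M : nat) (S : 'I_k -> {set 'I_m})
    (f f' : 'M[F]_(k, m) -> 'I_M -> F) :
  (forall v c, f v c = f' v c) -> regular_map S f -> regular_map S f'.
Proof.
move=> ff' fr v Sv; have [D [P [DP Pv Pf]]] := fr v Sv.
exists D, P; split=> // w Sw a b.
by rewrite -!ff'; exact: Pf.
Qed.

Section SeqPoint.
Variables (F : fieldType) (m : nat) (A : monalgebra F m).

Definition seq_mp (l : nat -> projspace F m) n : multiproj F n.+1 m :=
  [ffun i : 'I_n.+1 => l i].

Lemma seq_mp_locus l n : point_seq A l -> point_locus A (seq_mp l n).
Proof. by move=> Al; exists l => // i; rewrite ffunE. Qed.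

Definition seq_pt l (Al : point_seq A l) n : vpt (point_variety A n) :=
  exist _ _ (seq_mp_locus n Al).

Lemma vpt_inj (V : variety F) (x y : vpt V) : sval x = sval y -> x = y.
Proof.
case: x y => [x Vx] [y Vy] /= xy; move: Vx Vy; rewrite xy => Vx Vy.
by rewrite (proof_irrelevance _ Vx Vy).
Qed.

Lemma seq_pt_point l (Al : point_seq A l) :
  pv_point (V := point_provariety A) (seq_pt Al).
Proof. by move=> n; apply: vpt_inj; apply/ffunP => i; rewrite !ffunE. Qed.
End SeqPoint.

Section Retract.
Variables (F : closedFieldType).
Variables (m : nat) (A : monalgebra F m) (S : nat -> {set 'I_m}).
Hypothesis boxA : forall n (x : multiproj F n.+1 m),
  point_locus A x <-> forall i c, hcoord x i c != 0 -> c \in S i.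
Variable s0 : nat -> 'I_m.
Hypothesis s0S : forall n, s0 n \in S n.
Variables (m' : nat) (B : monalgebra F m') (T : nat -> {set 'I_m'}).
Hypothesis boxB : forall n (x : multiproj F n.+1 m'),
  point_locus B x <-> forall i c, hcoord x i c != 0 -> c \in T i.
Variable t0 : nat -> 'I_m'.
Hypothesis t0T : forall n, t0 n \in T n.
Variables (f : pvmorphism (point_provariety A) (point_provariety B)).
Variables (g : pvmorphism (point_provariety B) (point_provariety A)).
Hypothesis gf : forall a, pv_point a -> forall n, pv_map g (pv_map f a) n = a n.
Variable n : nat.

(** Unfolding [pv_map g (pv_map f a) n] gives a chain from level [h] of [A] to levels [k] and [e] of
    [B], then to levels [r] and [n] of [A]. *)
Let r := maxn (pvm_start g) n.
Let e := pvm_idx g r.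
Let k := maxn (pvm_start f) e.
Let h := pvm_idx f k.
Let fk : vpt (point_variety A h) -> vpt (point_variety B k) := pvm_map (p := f) (j := k).
Let gr : vpt (point_variety B e) -> vpt (point_variety A r) := pvm_map (p := g) (j := r).
Let down : vpt (point_variety B k) -> vpt (point_variety B e) :=
  pv_down (V := point_provariety B) (leq_maxr (pvm_start f) e).

Lemma retract_coord l (Al : point_seq A l) j (j' : 'I_r.+1) :
  j' = j :> nat -> (j <= n)%N -> sval (gr (down (fk (seq_pt Al h)))) j' = l j.
Proof.
move=> j'j jn; have ltj : (j < n.+1)%N by [].
have := congr1 (fun x : vpt (point_variety A n) => sval x (Ordinal ltj))
  (gf (seq_pt_point Al) n).
rewrite [RHS]ffunE /= => <-; rewrite /pv_map.
by rewrite (pv_downE _ _ (i := Ordinal ltj) (i' := j')).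
Qed.

Definition pad (N : nat) (j : nat) (c : 'I_m) : 'M[F]_(N.+1, m) :=
  \matrix_(i, a) (a == if i == j :> nat then c else s0 i)%:R.

Lemma boxed_pad N j c : c \in S j -> boxed (Sn S (n := N)) (pad N j c).
Proof.
move=> cS i; split.
  by exists (if i == j :> nat then c else s0 i); rewrite mxE eqxx oner_eq0.
move=> a; rewrite mxE; have [-> _|_] := eqVneq a (if _ then _ else _); last by rewrite eqxx.
by rewrite /Sn; case: eqP => [->|_] //; exact: s0S.
Qed.

Lemma pad_moves N (j : 'I_N.+1) c : c != s0 j ->
  ~ colinear (pad N j c j) (pad N j (s0 j) j).
Proof.
move=> cs /(_ c (s0 j)); rewrite !mxE !eqxx (negPf cs) eq_sym (negPf cs).
by rewrite mul1r mul0r; apply/eqP; rewrite oner_eq0.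
Qed.

Lemma pad_default N j : pad N j (s0 j) = pad N N.+1 (s0 N.+1).
Proof.
apply/matrixP => i a; rewrite !mxE [i == N.+1 :> nat]ltn_eqF //.
by have [->|] := eqVneq (i : nat) j.
Qed.

Lemma extend_boxed N v : boxed (Sn S (n := N)) v ->
  exists2 l, point_seq A l & forall i : 'I_N.+1, l i = mx_multiproj S s0 v i.
Proof.
move=> Sv; have [l Al lv] := mx_multiproj_locus boxA s0S v.
by exists l => // i; rewrite lv.
Qed.

(** Otherwise two points that agree up to level [h] and differ at [j] would have the same image
    under the composite. *)
Lemma retract_index j c : (j <= n)%N -> c \in S j -> c != s0 j -> (j <= h)%N.
Proof.
move=> jn cS cs; rewrite leqNgt; apply/negP => hj.
have S1 := @boxed_pad j j c cS; have S2 := @boxed_pad j j _ (s0S j).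
have [l Al lE] := extend_boxed S1; have [l' Al' l'E] := extend_boxed S2.
have ll' : seq_pt Al h = seq_pt Al' h.
  apply: vpt_inj; apply/ffunP => i; rewrite !ffunE.
  have ij : (i < j)%N by rewrite (leq_ltn_trans _ hj) // -ltnS.
  have lti : (i < j.+1)%N by rewrite ltnS ltnW.
  rewrite (lE (Ordinal lti)) (l'E (Ordinal lti)); apply: projspace_eq => a a'.
  have H1 := hcoord_mx s0 (Ordinal lti) S1; have H2 := hcoord_mx s0 (Ordinal lti) S2.
  have rE : pad j j c (Ordinal lti) =1 pad j j (s0 j) (Ordinal lti).
    by move=> b; rewrite !mxE /= ltn_eqF.
  have [[b pb] _] := S1 (Ordinal lti).
  have H3 : colinear (pad j j c (Ordinal lti))
      (hcoord (mx_multiproj S s0 (pad j j (s0 j))) (Ordinal lti)).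
    by move=> b1 b2; rewrite !rE; exact: (colinear_sym H2).
  by have := colinear_trans pb H1 H3 a a'; rewrite !mxE.
have jr : (j < r.+1)%N by rewrite ltnS leq_max jn orbT.
have := retract_coord Al (j' := Ordinal jr) erefl jn; rewrite ll'.
rewrite (retract_coord Al' (j' := Ordinal jr) erefl jn) => l'l.
have H1 := hcoord_mx s0 ord_max S1; have H2 := hcoord_mx s0 ord_max S2.
apply: (@pad_moves j ord_max c cs) => a a'.
have [b1 x1] := hcoord_neq0 (mx_multiproj S s0 (pad j j c)) ord_max.
have E : hcoord (mx_multiproj S s0 (pad j j c)) ord_max =1
         hcoord (mx_multiproj S s0 (pad j j (s0 j))) ord_max.
  by move=> b; rewrite !mxE -(lE ord_max) -(l'E ord_max) /= l'l.
apply: (colinear_trans x1 (colinear_sym H1)) => b b'.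
by rewrite !E; exact: H2.
Qed.

Let phi (v : 'M[F]_(h.+1, m)) : 'M[F]_(e.+1, m') :=
  hcoord (sval (down (fk (mx_pt boxA s0S v)))).
Let psi (j : 'I_h.+1) (y : 'M[F]_(e.+1, m')) : 'I_m -> F :=
  hcoord (sval (gr (mx_pt boxB t0T y))) (inord j).

Lemma mx_pt_hcoord (x : vpt (point_variety B e)) : mx_pt boxB t0T (hcoord (sval x)) = x.
Proof.
apply: vpt_inj; apply/ffunP => i; apply: projspace_eq => a a'.
by have := hcoord_mx t0 i (boxed_hcoord boxB x) a a'; rewrite !mxE.
Qed.

Lemma retract_in_boxed v : boxed (Sn T (n := e)) (phi v).
Proof. exact: boxed_hcoord. Qed.

Lemma retract_in_regular i : regular_map (Sn S (n := h)) (fun v => phi v i).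
Proof.
have fkm : vmorphism fk by exact: (@pvm_map_morphism _ _ _ f k (leq_maxl _ _)).
have lti : (i < k.+1)%N by rewrite ltnS (leq_trans _ (leq_maxr _ _)) // -ltnS.
have H := @regular_of_vmorphism F m A S boxA s0 s0S h (point_variety B k) fk (Ordinal lti) fkm.
refine (regular_map_ext _ H).
by move=> v c; rewrite !mxE /= (pv_downE _ _ (i' := Ordinal lti)).
Qed.

Lemma retract_in_rowscale v w : boxed (Sn S (n := h)) v -> boxed (Sn S (n := h)) w ->
  (forall i, colinear (v i) (w i)) -> phi v = phi w.
Proof.
move=> Sv Sw vw; rewrite /phi.
suff -> : mx_pt boxA s0S v = mx_pt boxA s0S w by [].
by apply: vpt_inj; exact: mx_pt_rowscale.
Qed.

Lemma retract_out_regular j : regular_map (Sn T (n := e)) (psi j).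
Proof.
have grm : vmorphism gr by exact: (@pvm_map_morphism _ _ _ g r (leq_maxl _ _)).
exact: (@regular_of_vmorphism F m' B T boxB t0 t0T e (point_variety A r) gr (inord j) grm).
Qed.

Lemma retract_out_neq0 j y : exists c, psi j y c != 0.
Proof. exact: hcoord_neq0. Qed.

Lemma retract_inK (j : 'I_h.+1) v : (j <= n)%N -> boxed (Sn S (n := h)) v ->
  colinear (psi j (phi v)) (v j).
Proof.
move=> jn Sv; rewrite /psi /phi mx_pt_hcoord.
have [l Al lE] := extend_boxed Sv.
have -> : mx_pt boxA s0S v = seq_pt Al h.
  by apply: vpt_inj; apply/ffunP => i; rewrite [RHS]ffunE lE.
have jr : (j < r.+1)%N by rewrite ltnS leq_max jn orbT.
move=> a a'; rewrite !mxE (retract_coord Al (j := j)) ?inordK // lE.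
by have := hcoord_mx s0 j Sv a a'; rewrite !mxE.
Qed.

(** [sigma j] is the factor of [B] that determines coordinate [j]. The inequalities are the tangent
    bound for one coordinate and for two that share a factor; a coordinate with a single letter is
    constant and carries no information. *)
Lemma retract_bound : exists sigma : nat -> nat, forall j,
  (j <= n)%N -> (1 < #|S j|)%N -> (#|S j| <= #|T (sigma j)|)%N /\
  forall j', (j' <= n)%N -> j' != j -> (1 < #|S j'|)%N -> sigma j' = sigma j ->
  (#|S j|.-1 + #|S j'|.-1 < #|T (sigma j)|)%N.
Proof.
(* The index [h.+1] lies outside the matrix, so every row takes its default letter. *)
pose b := pad h h.+1 (s0 h.+1).
have Sb : boxed (Sn S (n := h)) b by apply: boxed_pad; exact: s0S.
have moved j : (1 < #|S j|)%N -> exists2 c, c \in S j & c != s0 j.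
  rewrite (cardsD1 (s0 j)) s0S ltnS card_gt0 => /set0Pn[c].
  by rewrite !inE => /andP[cs cS]; exists c.
have [sigma sigmaP] : exists sigma : nat -> 'I_e.+1, forall j : 'I_h.+1,
    (j <= n)%N -> (1 < #|S j|)%N -> forall u, boxed (Sn S (n := h)) u ->
    colinear (psi j (mix [set sigma j] (phi u) (phi b))) (u j).
  have /fin_all_exists[sg sgP] (j : 'I_h.+1) : exists i, (j <= n)%N -> (1 < #|S j|)%N ->
      forall u, boxed (Sn S (n := h)) u ->
      colinear (psi j (mix [set i] (phi u) (phi b))) (u j).
    have [jS|jS] := ltnP 1 #|S j|; last by exists ord0.
    have [jn|jn] := leqP j n; last by exists ord0.
    have mv : exists2 v, boxed (Sn S (n := h)) v & ~ colinear (v j) (b j).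
      have [c cS cs] := moved j jS; exists (pad h j c); first exact: boxed_pad.
      by rewrite /b -(@pad_default h j); exact: pad_moves.
    have [i iP] := @factor_through_one F h.+1 m (Sn S (n := h)) e.+1 m' (Sn T (n := e))
      phi (fun v _ => retract_in_boxed v) retract_in_regular (phi b) (retract_in_boxed b)
      (psi j) (fun y _ => retract_out_neq0 j y) (retract_out_regular j) b j Sb erefl
      retract_in_rowscale
      (fun v => retract_inK jn (v := v)) mv.
    by exists i.
  exists (fun j => sg (inord j)) => j; rewrite inord_val; exact: sgP.
have bound (J : {set 'I_h.+1}) i : (forall j, j \in J ->
    [/\ (j <= n)%N, (1 < #|S j|)%N & sigma j = i]) ->
    (\sum_(j in J) #|S j|.-1 < #|T i|)%N.
  move=> JP.
  apply: (@tangent_bound F h.+1 m (Sn S (n := h)) e.+1 m' (Sn T (n := e))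
    phi (fun v _ => retract_in_boxed v) b (phi b) Sb (retract_in_boxed b) i J psi
    (retract_in_regular i)
    (fun j _ y _ => retract_out_neq0 j y) (fun j _ => retract_out_regular j)).
  by move=> j /JP[jn jS <-]; exact: sigmaP.
have le_h j : (j <= n)%N -> (1 < #|S j|)%N -> (j < h.+1)%N.
  by move=> jn /moved[c cS cs]; rewrite ltnS; exact: retract_index cS cs.
exists (fun j => sigma j) => j jn jS; have jh := le_h j jn jS; split.
  have := bound [set Ordinal jh] (sigma j); rewrite big_set1 /=.
  rewrite prednK ?(ltn_trans _ jS) //; apply=> j'; rewrite inE => /eqP-> /=.
  by split.
move=> j' j'n j'j j'S ss; have j'h := le_h j' j'n j'S.
have := bound [set Ordinal jh; Ordinal j'h] (sigma j).
rewrite big_setU1 ?big_set1 /=; last by rewrite inE -val_eqE /= eq_sym.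
apply=> i; rewrite !inE => /orP[] /eqP -> /=; split=> //.
exact: val_inj.
Qed.
End Retract.

From mathcomp Require Import finmap monalg mpoly.

(** * Supports of points and non-zero words *)

Section Wprod.
Variables (F : fieldType) (m : nat).
Implicit Types (c : nat -> 'rV[F]_m) (w : seq 'I_m).

Lemma wprod_shift c i w : wprod (fun i => c i.+1) i w = wprod c i.+1 w.
Proof. by elim: w i => //= j w IHw i; rewrite IHw. Qed.

Lemma wprod_local c c' i w :
  (forall k, (i <= k < i + size w)%N -> c k = c' k) -> wprod c i w = wprod c' i w.
Proof.
elim: w i => //= j w IHw i cc'; rewrite cc'; last by rewrite leqnn addnS ltnS leq_addr.
by rewrite IHw // => k /andP[ik kw]; apply: cc'; rewrite (ltnW ik) addnS -addSn.
Qed.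

Lemma wprod_neq0 c i w x0 :
  reflect (forall k, (k < size w)%N -> c (i + k)%N 0 (nth x0 w k) != 0)
          (wprod c i w != 0).
Proof.
elim: w i => [|j w IHw] i /=; first by rewrite oner_eq0; apply: ReflectT.
rewrite mulf_eq0 negb_or; apply: (iffP andP) => [[cj /IHw cw] [|k] kw|cw].
- by rewrite addn0.
- by rewrite addnS -addSn; exact: cw.
split; first by have := cw 0%N isT; rewrite addn0.
by apply/IHw => k kw; rewrite addSn -addnS; exact: (cw k.+1).
Qed.
End Wprod.

Section Support.
Variables (F : closedFieldType) (m : nat) (A : monalgebra F m).

Definition psupp (i : nat) : {set 'I_m} :=
  [set c | if excluded_middle_informative
             (exists2 l, point_seq A l & pcoord (l i) 0 c != 0) then true else false].

Lemma psuppP i c :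
  reflect (exists2 l, point_seq A l & pcoord (l i) 0 c != 0) (c \in psupp i).
Proof.
rewrite inE; case: excluded_middle_informative => H; first exact: ReflectT.
exact: ReflectF.
Qed.

(** Relations are imposed at every position, so a shifted point sequence is again one; in terms of
    modules, this is the part of degree at least 1. *)
Lemma psupp_decr i : psupp i.+1 \subset psupp i.
Proof.
apply/subsetP => c /psuppP[l Al lc]; apply/psuppP; exists (fun i => l i.+1) => //.
apply/point_seqP => w Aw j.
rewrite (wprod_shift (fun i => pcoord (l i))).
by move/point_seqP: Al; apply.
Qed.

Lemma psupp_sub i j : (i <= j)%N -> psupp j \subset psupp i.
Proof.
move=> /subnK <-; elim: (j - i)%N => // k IHk.
exact: subset_trans (psupp_decr _) IHk.
Qed.

(** Shrinking the supports of a point preserves monomial relations, so one point with the largest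
    supports makes [P_n(A)] the whole product of the [P(psupp i)]. *)
Definition full_support : Prop := forall n, exists2 l, point_seq A l &
  forall i, (i <= n)%N -> forall c, c \in psupp i -> pcoord (l i) 0 c != 0.

Hypothesis full : full_support.

Lemma psupp_point_seq l :
  (forall i c, pcoord (l i) 0 c != 0 -> c \in psupp i) -> point_seq A l.
Proof.
move=> lS; apply/point_seqP => w Aw i; have [l' Al' l'S] := full (i + size w).
pose c k := if (k < i + size w)%N then pcoord (l k) else pcoord (l' k).
rewrite (wprod_local (c' := c)); last by move=> k /andP[_ kw]; rewrite /c kw.
apply: (@wprod_eq0 _ _ (fun k => pcoord (l' k))); last by move/point_seqP: Al'; apply.
move=> k a; rewrite /c; case: ltnP => // kw.
apply: contraTT => la; apply: l'S; first exact: ltnW.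
exact: lS.
Qed.

Lemma point_locus_psupp n (x : multiproj F n.+1 m) :
  point_locus A x <-> forall i c, hcoord x i c != 0 -> c \in psupp i.
Proof.
split=> [[l Al xl] i c|xS].
  by rewrite mxE xl => lc; apply/psuppP; exists l.
have [l0 Al0 _] := full 0.
exists (fun i => if insub i is Some i' then x i' else l0 i) => [|i]; last by rewrite valK.
apply: psupp_point_seq => i c; case: insubP => [i' _ <-|_] H.
  by apply: xS; rewrite mxE.
by apply/psuppP; exists l0.
Qed.

Lemma psupp_neq0 i : psupp i != set0.
Proof.
have [l Al _] := full 0; have /rV0Pn[c lc] := pcoord_neq0 (l i).
by apply/set0Pn; exists c; apply/psuppP; exists l.
Qed.

End Support.

Lemma regular_line_open (F : closedFieldType) (k m M : nat) (S : 'I_k -> {set 'I_m})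
    (f : 'M[F]_(k, m) -> 'I_M -> F) c :
  (forall v, boxed S v -> exists e, f v e != 0) -> regular_map S f ->
  line_open S (fun v => f v c != 0).
Proof.
move=> f0 freg v w Sv Sw fvc; have [D [P [DP [e Pe] Pf]]] := freg v Sv.
pose g := mxeval polyC (line_poly v w) (P c).
have gE t : g.[t] = mxev (line v w t) (P c) by rewrite mxev_horner line_polyE.
exists g; split.
  rewrite gE line0; apply: contraNneq Pe => Pc; have := Pf v Sv e c.
  by rewrite /= Pc mul0r => /eqP; rewrite mulf_eq0 (negPf fvc) orbF.
move=> t St; rewrite gE => Pc; have [b fb] := f0 _ St.
apply: contraNneq fb => fc; have := Pf _ St c b.
by rewrite /= fc mulr0 => /eqP; rewrite mulf_eq0 (negPf Pc).
Qed.

Section FullSupport.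
Variables (F : closedFieldType) (m m' : nat) (A : monalgebra F m) (B : monalgebra F m').
Variable T : nat -> {set 'I_m'}.
Hypothesis boxB : forall n (x : multiproj F n.+1 m'),
  point_locus B x <-> forall i c, hcoord x i c != 0 -> c \in T i.
Variable t0 : nat -> 'I_m'.
Hypothesis t0T : forall n, t0 n \in T n.
Variables (f : pvmorphism (point_provariety A) (point_provariety B)).
Variables (g : pvmorphism (point_provariety B) (point_provariety A)).
Hypothesis gf : forall a, pv_point a -> forall n, pv_map g (pv_map f a) n = a n.
Variable l0 : nat -> projspace F m.
Hypothesis Al0 : point_seq A l0.

(* P_n(A) is the image of an irreducible variety, and being a coordinate is
   non-zero at some point is an open condition. *)
Lemma retract_full_support : full_support A.
Proof.
move=> n; pose r := maxn (pvm_start g) n; pose e := pvm_idx g r.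
pose gr : vpt (point_variety B e) -> vpt (point_variety A r) := pvm_map (p := g) (j := r).
pose mp (y : 'M[F]_(e.+1, m')) := mx_pt boxB t0T y.
pose O (z : 'I_n.+1 * 'I_m) (y : 'M[F]_(e.+1, m')) :=
  hcoord (sval (gr (mp y))) (inord z.1) z.2 != 0 : Prop.
have oO z : line_open (Sn T (n := e)) (O z).
  apply: (@regular_line_open F e.+1 m' m (Sn T (n := e))
    (fun y => hcoord (sval (gr (mp y))) (inord z.1)) z.2).
    by move=> v _; exact: hcoord_neq0.
  exact: (@regular_of_vmorphism F m' B T boxB t0 t0T e (point_variety A r) gr _
    (@pvm_map_morphism _ _ _ g r (leq_maxl _ _))).
(* As [g] inverts [f] on points, every point of [A], read up to level [n], is the image of a boxed
   matrix. *)
have point l (Al : point_seq A l) : exists2 y, boxed (Sn T (n := e)) y &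
    forall i : 'I_n.+1, sval (gr (mp y)) (inord i) = l i.
  pose k := maxn (pvm_start f) e.
  pose b : vpt (point_variety B e) := pv_down (V := point_provariety B)
    (leq_maxr (pvm_start f) e) (pvm_map (p := f) (j := k) (seq_pt Al (pvm_idx f k))).
  exists (hcoord (sval b)); first exact: boxed_hcoord.
  move=> i; rewrite /mp mx_pt_hcoord.
  apply: (retract_coord gf Al (n := n)); last by rewrite -ltnS.
  by rewrite inordK // ltnS leq_max -[(i <= n)%N]ltnS ltn_ord orbT.
have [y0 Sy0 _] := point _ Al0.
have oall (s : seq ('I_n.+1 * 'I_m)) :
    line_open (Sn T (n := e)) (fun y => forall z, z \in s -> O z y).
  elim: s => [|z s IHs] v w Sv Sw H; first by exists 1; rewrite hornerC oner_eq0.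
  have Oz : O z v by apply: H; rewrite mem_head.
  have Os z' : z' \in s -> O z' v by move=> z's; apply: H; rewrite inE z's orbT.
  have [q [q0 qO]] := line_open_and (oO z) IHs Sv Sw (conj Oz Os).
  exists q; split=> // t St qt z'; have [Ozt Ost] := qO t St qt.
  by rewrite inE => /orP[/eqP->|/Ost].
have ally (s : seq ('I_n.+1 * 'I_m)) : (forall z, z \in s -> z.2 \in psupp A z.1) ->
    exists2 y, boxed (Sn T (n := e)) y & forall z, z \in s -> O z y.
  elim: s => [|[i c] s IHs] sP; first by exists y0.
  have [z zs|y Sy Oy] := IHs; first by apply: sP; rewrite inE zs orbT.
  have /psuppP[l Al lc] := sP (i, c) (mem_head _ _).
  have [y' Sy' y'l] := point l Al.
  have Oy' : O (i, c) y' by rewrite /O /= mxE y'l.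
  have [u [Su Ou Osu]] := line_open_meet (oO (i, c)) (oall s) Sy' Sy Oy' Oy.
  by exists u => // z; rewrite inE => /orP[/eqP->|/Osu].
have [z|y Sy Oy] := ally [seq z : 'I_n.+1 * 'I_m <- enum {: 'I_n.+1 * 'I_m} | z.2 \in psupp A z.1].
  by rewrite mem_filter => /andP[].
have [l Al ly] := svalP (gr (mp y)); exists l => // i iltn c ci.
have lti : (i < n.+1)%N by [].
have := Oy (Ordinal lti, c); rewrite mem_filter mem_enum ci => /(_ isT).
by rewrite /O /= mxE ly inordK // ltnS leq_max iltn orbT.
Qed.
End FullSupport.

Lemma free_point_locus (F : closedFieldType) (d : nat) n (x : multiproj F n.+1 d) :
  point_locus (free_monalgebra F d) x <->
  forall i c, hcoord x i c != 0 -> c \in (fun=> [set: 'I_d]) (i : nat).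
Proof.
split=> [_ i c _|_]; first by rewrite inE.
exists (fun i => if insub i is Some i' then x i' else x ord0) => [|i]; last by rewrite valK.
by apply/point_seqP => w.
Qed.

Section Words.
Variables (F : closedFieldType) (m : nat) (A : monalgebra F m).
Implicit Types (w s : seq 'I_m).

Definition mword w : A := ma_mon A (FMonom w).

Lemma mwordM u v : mword (u ++ v) = mword u * mword v.
Proof.
rewrite /mword /ma_mon -rmorphM -monM; congr (ma_proj A (mon F _)).
by apply/eqP; rewrite fmP fmM.
Qed.

Lemma mword_nil : mword [::] = 1.
Proof. by rewrite /mword /ma_mon mon_nil rmorph1. Qed.

Lemma mword_rel (w : {fmonom 'I_m}) : ma_rel A w -> mword w = 0.
Proof.
move=> Aw; apply/ma_ker; exists 1%N, (fun=> 1), (fun=> mon F w), (fun=> 1).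
by split=> [_|]; [exists w | rewrite big_ord1 mul1r mulr1 fmK].
Qed.

(** Every monomial of a term [a i * s i * b i] contains the relation [s i] as a factor, so
    membership in the ideal shows on each monomial of the support. *)
Lemma ker_supp (p : freealg F m) (w : {fmonom 'I_m}) :
  ma_proj A p = 0 -> monalg.mcoeff w p != 0 ->
  exists (a r b : {fmonom 'I_m}), ma_rel A r /\ w = a ++ r ++ b :> seq 'I_m.
Proof.
case/ma_ker=> n [a [s [b [Hs ->]]]].
rewrite (raddf_sum (@monalg.mcoeff {fmonom 'I_m} F w)) => sum0.
have [i] : exists i, monalg.mcoeff w (a i * s i * b i) != 0.
  apply: NNPP => /not_ex_all_not H; case/eqP: sum0; apply: big1 => i _.
  by apply/eqP/negPn/negP; exact: H.
rewrite monalg.mcoeff_neq0 => /(@monalg.msuppM_le {fmonom 'I_m} F)[u [v [uas _ ->]]].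
have [u1 [u2 [_ u2s ->]]] := @monalg.msuppM_le {fmonom 'I_m} F _ _ _ uas.
have [r Ar sr] := Hs i; rewrite sr /mon monalg.msuppU oner_eq0 in u2s.
move: u2s; rewrite inE => /eqP u2r.
by exists u1, u2, v; rewrite !fmM catA u2r.
Qed.

Lemma mword_ker (p : freealg F m) (w : {fmonom 'I_m}) :
  ma_proj A p = 0 -> monalg.mcoeff w p != 0 -> mword w = 0.
Proof.
move=> /ker_supp H /H[a [r [b [Ar ->]]]].
by rewrite !mwordM (mword_rel Ar) mul0r mulr0.
Qed.

Lemma mword0_rel w : mword w = 0 ->
  exists (a r b : {fmonom 'I_m}), ma_rel A r /\ w = a ++ r ++ b.
Proof.
move=> w0; apply: (@ker_supp (mon F (FMonom w)) (FMonom w)) => //.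
by rewrite /mon monalg.mcoeffU eqxx oner_eq0.
Qed.

Hypothesis prolA : prolongable A.

Lemma prolong_letter : exists x0 : 'I_m, True.
Proof.
have [|v v1 _] := prolA (u := FMonom [::]).
  by rewrite /ma_mon mon_nil rmorph1 oner_eq0.
have: (v : seq 'I_m) != [::] by rewrite -fm1 -fmP.
by case: (v : seq 'I_m) => // x0 *; exists x0.
Qed.

Lemma prolong_step (w : {w : seq 'I_m | mword w != 0}) :
  exists w' : {w : seq 'I_m | mword w != 0},
    exists2 v, v != [::] & sval w' = sval w ++ v.
Proof.
case: w => w w0 /=; have [v v1 wv] := prolA w0.
have wv0 : mword (w ++ v) != 0 by rewrite mwordM {2}/mword fmK.
by exists (exist (fun w => is_true (mword w != 0)) _ wv0), (v : seq 'I_m) => //; rewrite -fm1 -fmP.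
Qed.

(** Prolongation is iterated from [w]. Each finite stretch of the limit word lies in a non-zero
    word, so it is not a relation. *)
Lemma infinite_word w x0 : mword w != 0 -> exists z : nat -> 'I_m,
  (forall k, (k < size w)%N -> z k = nth x0 w k) /\
  (forall (a : nat) (r : {fmonom 'I_m}), ma_rel A r ->
     exists2 k, (k < size r)%N & z (a + k)%N != nth x0 r k).
Proof.
move=> w0; pose next u := sval (constructive_indefinite_description _ (prolong_step u)).
have nextP u : exists2 v, v != [::] & sval (next u) = sval u ++ v.
  by rewrite /next; case: constructive_indefinite_description.
pose W n := sval (iter n next (exist (fun w => is_true (mword w != 0)) w w0)).
have WS n : exists2 v, v != [::] & W n.+1 = W n ++ v by exact: (nextP (iter n next _)).
have W0 n : mword (W n) != 0 by exact: (svalP (iter n next _)).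
have sizeW n : (n <= size (W n))%N.
  elim: n => // n IHn; have [v v0 ->] := WS n; rewrite size_cat.
  by case: v v0 => // a v _ /=; rewrite addnS ltnS (leq_trans IHn) ?leq_addr.
have Wnth n n' k : (n <= n')%N -> (k < size (W n))%N ->
    (k < size (W n'))%N /\ nth x0 (W n') k = nth x0 (W n) k.
  move=> /subnK <- kn; elim: (n' - n)%N => // j [IH1 IH2].
  rewrite addSn; have [v _ ->] := WS (j + n)%N.
  by rewrite nth_cat IH1 size_cat (leq_trans IH1) ?leq_addr.
exists (fun k => nth x0 (W k.+1) k); split=> [k kw|a r Ar].
  by have [] := Wnth 0%N k.+1 k (leq0n _) kw.
apply: NNPP => nex; pose n := (a + size r)%N.
have zW k : (k < n)%N -> nth x0 (W k.+1) k = nth x0 (W n) k.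
  by move=> kn; have [] := Wnth k.+1 n k kn (sizeW _).
case/eqP: (W0 n); rewrite -(cat_take_drop a (W n)) -(cat_take_drop (size r) (drop a _)).
rewrite !mwordM (_ : take (size r) (drop a (W n)) = r).
  by rewrite (mword_rel Ar) mul0r mulr0.
have szr : size (take (size r) (drop a (W n))) = size r.
  by rewrite size_takel // size_drop leq_subRL ?(leq_trans _ (sizeW n)) ?leq_addr // addnC.
apply: (@eq_from_nth _ x0) => // k; rewrite szr => kr.
rewrite nth_take // nth_drop -zW; last by rewrite ltn_add2l.
by apply/eqP/negPn/negP => H; apply: nex; exists k.
Qed.

Lemma letter_line_dim (c : 'I_m) : \dim <[delta_mx 0 c : 'rV[F]_m]> == 1%N.
Proof.
rewrite dim_vline; suff -> : delta_mx 0 c != 0 :> 'rV[F]_m by [].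
by apply/rV0Pn; exists c; rewrite mxE !eqxx oner_eq0.
Qed.

Definition letter_line c : projspace F m := ProjSpace (letter_line_dim c).

Lemma letter_lineE c a : (pcoord (letter_line c) 0 a != 0) = (a == c).
Proof.
have H := @pcoord_eq_line _ _ (letter_line c) _ erefl.
have /rV0Pn[e ee] := pcoord_neq0 (letter_line c).
have ca b : b != c -> pcoord (letter_line c) 0 b = 0.
  by move=> bc; have := H b c; rewrite !mxE !eqxx (negPf bc) mulr1 mulr0.
have [->|/ca->] := eqVneq a c; last by rewrite eqxx.
by apply: contraNneq ee => c0; have [->|/ca->] := eqVneq e c; rewrite ?c0.
Qed.

Lemma word_point_seq w x0 : mword w != 0 -> exists l, point_seq A l /\
  forall k, (k < size w)%N -> pcoord (l k) 0 (nth x0 w k) != 0.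
Proof.
move=> /(infinite_word x0)[z [zw zr]]; exists (fun k => letter_line (z k)).
split=> [|k kw]; last by rewrite letter_lineE zw.
apply/point_seqP => r Ar i; apply/eqP/negPn/negP => /(wprod_neq0 _ _ _ x0) H.
have [k kr] := zr i r Ar; have := H k kr.
by rewrite letter_lineE eq_sym => ->.
Qed.

(** A non-zero word extends to an infinite one, which is a point with one letter at each position.
    Conversely, a relation inside [w] forces a zero coordinate on that stretch of a point of full
    support, so some letter is outside [psupp]. *)
Lemma mword_neq0 (full : full_support A) w x0 :
  reflect (forall k, (k < size w)%N -> nth x0 w k \in psupp A k) (mword w != 0).
Proof.
apply: (iffP idP) => [/(word_point_seq x0)[l [Al lw]] k kw|wS].
  by apply/psuppP; exists l => //; exact: lw.
apply/eqP => /mword0_rel[a [r [b [Ar wE]]]].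
have [l Al lS] := full (size w); move/point_seqP: Al => /(_ r Ar (size a)) /eqP.
apply/negP/(wprod_neq0 _ _ _ x0) => k kr; rewrite wE !size_cat in lS wS.
have kab : (size a + k < size a + (size r + size b))%N.
  by rewrite ltn_add2l (leq_trans kr) ?leq_addr.
apply: lS; first exact: ltnW.
have := wS (size a + k)%N kab.
by rewrite nth_cat ltnNge leq_addr /= addKn nth_cat kr.
Qed.
End Words.

(** * Relabelling a free algebra *)

Section Inverse.
Variables (F : fieldType) (A B : algType F) (f : {lrmorphism A -> B}).
Hypotheses (f_inj : injective f) (f_surj : forall b, exists a, f a == b).

Definition lr_inv (b : B) : A := xchoose (f_surj b).

Lemma lr_invK : cancel lr_inv f.
Proof. by move=> b; apply/eqP; exact: (xchooseP (f_surj b)). Qed.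

Lemma lr_inv_linear : linear lr_inv.
Proof. by move=> a u v; apply: f_inj; rewrite linearP /= !lr_invK. Qed.

Lemma lr_inv_monoid : monoid_morphism lr_inv.
Proof.
split=> [|u v]; apply: f_inj; first by rewrite rmorph1 lr_invK.
by rewrite rmorphM /= !lr_invK.
Qed.

HB.instance Definition _ := GRing.isLinear.Build F B A _ lr_inv lr_inv_linear.
HB.instance Definition _ := GRing.isMonoidMorphism.Build B A lr_inv lr_inv_monoid.

Lemma alg_iso_of_bijection : alg_iso B A.
Proof.
exists lr_inv; exists f; first exact: lr_invK.
by move=> a; apply: f_inj; rewrite lr_invK.
Qed.
End Inverse.

Section Relabel.
Variables (F : closedFieldType) (m d : nat) (A : monalgebra F m).
Variable io : 'I_d -> 'I_m.

Definition relabel_mon (w : {fmonom 'I_d}) : A := mword A (map io w).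

Lemma relabel_mon_mmorphism : monalg.mmorphism relabel_mon.
Proof.
split=> [u v|]; last by rewrite /relabel_mon fm1 mword_nil.
by rewrite /relabel_mon fmM map_cat mwordM.
Qed.
HB.instance Definition _ :=
  monalg.isMultiplicative.Build {fmonom 'I_d} A relabel_mon relabel_mon_mmorphism.

Definition relabel (p : freealg F d) : A :=
  monalg.mmap (GRing.in_alg A) relabel_mon p.

Lemma relabel_linear : linear relabel.
Proof.
move=> a u v; rewrite /relabel.
rewrite (monalg.mmapD (a *: u : malg _ F)) (monalg.mmapZ a (u : malg _ F)).
by rewrite /= mulr_algl.
Qed.

Lemma relabel_monoid : monoid_morphism relabel.
Proof.
have [HM H1] := @monalg.commr_mmap_is_multiplicative {fmonom 'I_d} F A
  (GRing.in_alg A) relabel_mon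
  (fun g u v => etrans (mulr_algl _ _) (esym (mulr_algr _ _))).
by split.
Qed.

HB.instance Definition _ :=
  GRing.isLinear.Build F (freealg F d) A _ relabel relabel_linear.
HB.instance Definition _ :=
  GRing.isMonoidMorphism.Build (freealg F d) A relabel relabel_monoid.

Hypothesis io_inj : injective io.
Hypothesis words_neq0 : forall w : seq 'I_m,
  (mword A w != 0) = all (mem (codom io)) w.

(** By [io_inj] distinct words stay distinct, so nothing cancels in [q], and [mword_ker] would kill
    a word in the chosen letters. *)
Lemma relabel_inj : injective relabel.
Proof.
have ker0 p : relabel p = 0 -> p = 0.
  move=> p0; pose q : freealg F m :=
    \sum_(w <- monalg.msupp p) monalg.mcoeff w p *: mon F (FMonom (map io w)).
  have q0 : ma_proj A q = 0.
    rewrite -p0 /q linear_sum; apply: eq_bigr => w _.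
    by rewrite linearZ /= mulr_algl.
  apply/(@malgP {fmonom 'I_d} F) => w; rewrite monalg.mcoeff0.
  apply/eqP/negPn/negP => pw.
  have qw : monalg.mcoeff (FMonom (map io w)) q = monalg.mcoeff w p.
    rewrite /q (raddf_sum (@monalg.mcoeff {fmonom 'I_m} F _)) /=.
    rewrite (bigD1_seq w) ?fset_uniq -?monalg.mcoeff_neq0 //= big1.
      by rewrite addr0 (monalg.mcoeffZ _ (<<_>> : malg _ F)) monalg.mcoeffU eqxx mulr1.
    move=> u uw; rewrite (monalg.mcoeffZ _ (<<_>> : malg _ F)) monalg.mcoeffU.
    case: eqP => [[/(inj_map io_inj) uw']|_]; last by rewrite mulr0.
    by case/eqP: uw; apply/eqP; rewrite fmP uw'.
  have := @mword_ker F m A q (FMonom (map io w)) q0; rewrite qw => /(_ pw) /eqP.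
  apply/negP; rewrite words_neq0; apply/allP => _ /mapP[c _ ->].
  exact: codom_f.
move=> u v uv; apply/eqP; rewrite -subr_eq0; apply/eqP/ker0.
by rewrite linearB /= uv subrr.
Qed.

Lemma relabel_surj a : exists p, relabel p == a.
Proof.
have [p <-] := ma_surj a; elim/freealg_ind: p => [|c u v [pu /eqP Eu] [pv /eqP Ev]|w].
- by exists 0; rewrite !linear0.
- by exists (c *: pu + pv); rewrite !linearP /= Eu Ev.
have [w0|] := eqVneq (mword A w) 0.
  by exists 0; rewrite linear0 eq_sym -[X in _ == X]w0 /mword fmK.
rewrite words_neq0 => /allP wio.
have [s sw] : exists s, map io s = w.
  elim: (w : seq _) wio => [|c s IHs] cs; first by exists [::].
  have [t <-] : exists t, map io t = s by apply: IHs => e es; apply: cs; rewrite inE es orbT.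
  by have /codomP[e ->] := cs c (mem_head _ _); exists (e :: t).
exists (mon F (FMonom s)); rewrite /relabel /mon.
rewrite (monalg.mmapU (1 : F) (FMonom s)) /= scale1r mul1r /relabel_mon /=.
by rewrite sw /mword fmK.
Qed.

Lemma relabel_iso : alg_iso A (freealg F d).
Proof. exact: alg_iso_of_bijection relabel_inj relabel_surj. Qed.
End Relabel.

(** * Cardinalities of the supports and conclusion *)

Lemma leq_inj_bound (sigma : nat -> nat) t :
  (forall j, (j <= t)%N -> (sigma j < t)%N) ->
  ~ (forall j j', (j <= t)%N -> (j' <= t)%N -> sigma j = sigma j' -> j = j').
Proof.
move=> st sinj; have : (size (map sigma (iota 0 t.+1)) <= size (iota 0 t))%N.
  apply: uniq_leq_size.
    have inj : {in iota 0 t.+1 &, injective sigma}.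
      by move=> j j'; rewrite !mem_iota !add0n !ltnS /= => jt j't; exact: sinj.
    by rewrite (map_inj_in_uniq inj) iota_uniq.
  by move=> x /mapP[j jt ->]; rewrite !mem_iota !add0n ltnS /= in jt *; exact: st.
by rewrite size_map !size_iota ltnn.
Qed.

Theorem theorem7p3 (F : closedFieldType) (m d : nat) (A : monalgebra F m) :
  prolongable A ->
  pv_iso (point_provariety A) (point_provariety (free_monalgebra F d)) ->
  alg_iso A (freealg F d).
Proof.
move=> prolA [f [g [gf fg]]].
have [x0 _] := prolong_letter prolA.
have one0 : mword A [::] != 0 by rewrite mword_nil oner_eq0.
have [l0 [Al0 _]] := word_point_seq prolA x0 one0.
(* A point of [A] exists, and its image needs a non-zero coordinate, so [d] is positive. *)
have [c0 _] : exists c0 : 'I_d, True.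
  by have [c _] := hcoord_neq0 (sval (pv_map f (seq_pt Al0) 0%N)) ord0; exists c.
have d0 : (0 < d)%N := leq_ltn_trans (leq0n _) (ltn_ord c0).
pose t0 (_ : nat) := c0; pose T (_ : nat) := [set: 'I_d].
have t0T n : t0 n \in T n by rewrite inE.
have boxB n x : point_locus (free_monalgebra F d) x <->
    forall (i : 'I_n.+1) c, hcoord x i c != 0 -> c \in T i.
  exact: free_point_locus.
have full := retract_full_support boxB t0T gf Al0.
have boxA := point_locus_psupp full.
have /all_sig[s0 s0S] n : {c | c \in psupp A n}.
  by apply: sigW; apply/set0Pn; exact: psupp_neq0.
have cardT n : #|T n| = d by rewrite cardsT card_ord.
have S0d : (#|psupp A 0| <= d)%N.
  have [sigma sP] := retract_bound boxA s0S boxB t0T gf 0%N.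
  have [S1|S1] := ltnP 1 #|psupp A 0|; last exact: leq_trans S1 d0.
  by have [] := sP 0%N (leqnn _) S1; rewrite cardT.
(* For [j <= t] the support at [sigma j] has at least [d] letters, so [sigma j] precedes [t] because
   supports decrease. By counting, two indices share a factor, and [2 * (d - 1) < d] fails for
   [d > 1]. *)
have Sd t : (d <= #|psupp A t|)%N.
  rewrite leqNgt; apply/negP => St.
  have d1 : (1 < d)%N.
    by apply: leq_trans St; rewrite ltnS card_gt0; exact: psupp_neq0.
  have [sigma sP] := retract_bound boxB t0T boxA s0S fg t.
  have sle j : (j <= t)%N -> (d <= #|psupp A (sigma j)|)%N.
    by move=> jt; have := sP j jt; rewrite cardT => /(_ d1)[].
  apply: (@leq_inj_bound sigma t) => [j jt|j j' jt j't ss].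
    rewrite ltnNge; apply/negP => ts; have := sle j jt; apply/negP; rewrite -ltnNge.
    exact: leq_ltn_trans (subset_leq_card (psupp_sub A ts)) St.
  apply/eqP; apply: contraT => jj'.
  have := sP j' j't; rewrite cardT => /(_ d1)[_ /(_ j jt jj')].
  rewrite ?cardT => /(_ d1 ss) H.
  have := leq_trans (subset_leq_card (psupp_sub A (leq0n (sigma j')))) S0d.
  by move: H d1; lia.
have S0E t : psupp A t = psupp A 0.
  by apply/eqP; rewrite eqEcard psupp_sub //= (leq_trans S0d).
have cS : #|psupp A 0| = d by apply/eqP; rewrite eqn_leq S0d Sd.
pose io (c : 'I_d) : 'I_m := enum_val (cast_ord (esym cS) c).
apply: (@relabel_iso F m d A io).
  by move=> c c' /enum_val_inj/cast_ord_inj.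
have ioS c : (c \in codom io) = (c \in psupp A 0).
  apply/codomP/idP => [[e ->]|cin]; first exact: enum_valP.
  by exists (cast_ord cS (enum_rank_in cin c)); rewrite /io cast_ordK enum_rankK_in.
move=> w; apply/(mword_neq0 prolA full w x0)/allP => H.
  move=> c cw; rewrite /= ioS; have := H (index c w).
  by rewrite index_mem cw nth_index // S0E; apply.
by move=> k kw; rewrite S0E -ioS; apply: H; exact: mem_nth.
Qed.
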